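(* Let $E_I^*\in\mathbb{R}^m_{>0}$, let $K_I$ be diagonal with negative diagonal entries, let $\tau_I$ be diagonal with positive diagonal entries, and let $Q_L(E_L)=(Q_1(E_1),\dots,Q_n(E_n))$ be a static load model with each $Q_i$ smooth. Consider the closed-loop differential-algebraic system $$\begin{pmatrix}\mathbf 0_n\\ \tau_I\dot E_I\end{pmatrix}=\begin{pmatrix}Q_L(E_L)\\ [E_I]K_I(E_I-E_I^* )\end{pmatrix}+[E]BE,\qquad E=(E_L,E_I).$$ Let $E_L\in\mathbb{R}^n_{>0}$ be a solution of the reduced power flow equation $$\mathbf 0_n=Q_L(E_L)+[E_L]B_{\rm red}(E_L-E_L^* ),$$ and let $E_I=W_2\begin{pmatrix}E_L\\ E_I^*\end{pmatrix}$ be the associated inverter voltages. If the Jacobian of the reduced power flow equation, $$J_{\rm red}(E_L)=\frac{\partial Q_L}{\partial E_L}(E_L)+[E_L]B_{\rm red}+[B_{\rm red}(E_L-E_L^* )],$$ evaluated at the solution $E_L$ is a Hurwitz matrix, then the equilibrium point $(E_L,E_I)$ of the closed-loop system is locally exponentially stable. Moreover, assuming that $\frac{\partial Q_i(E_i)}{\partial E_i}\le 0$ for each load bus $i\in\mathcal L$, a sufficient condition for $J_{\rm red}(E_L)$ to be Hurwitz is that $$B_{\rm red}\prec[E_L]^{-2}[Q_L(E_L)].$$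
   Context: Network: $n,m\ge 1$ are integers, $\mathcal L=\{1,\dots,n\}$ is the set of load buses, $\mathcal I=\{n+1,\dots,n+m\}$ the set of inverter buses, and $G$ is a connected undirected weighted graph on $\mathcal L\cup\mathcal I$ with edge set $\mathcal E$. The susceptance matrix $B\in\mathbb{R}^{(n+m)\times(n+m)}$ is symmetric with $B_{ij}=B_{ji}>0$ if $\{i,j\}\in\mathcal E$, $B_{ij}=0$ for $i\neq j$ with $\{i,j\}\notin\mathcal E$, and $B_{ii}=-\sum_{j\ne i}B_{ij}$. For a vector $x$, $[x]$ is the diagonal matrix with $x$ on the diagonal; $\mathbf 0_n$ is the zero vector. Block partition according to loads and inverters: $E=(E_L,E_I)$ and $B=\begin{pmatrix}B_{LL}&B_{LI}\\ B_{IL}&B_{II}\end{pmatrix}$. The diagonal matrix $K_I=\mathrm{diag}(K_i)_{i\in\mathcal I}$ contains controller gains $K_i<0$, $\tau_I=\mathrm{diag}(\tau_i)_{i\in\mathcal I}$ time constants, and $E_I^*=(E_i^* )_{i\in\mathcal I}$ voltage set points. Define $$B_{\rm red}=B_{LL}-B_{LI}(B_{II}+K_I)^{-1}B_{IL},\qquad W_1=-B_{\rm red}^{-1}B_{LI}(B_{II}+K_I)^{-1}K_I,$$ $$W_2=(B_{II}+K_I)^{-1}\begin{pmatrix}-B_{IL}&K_I\end{pmatrix},\qquad E_L^*=W_1E_I^*.$$ (The inverses exist.) A matrix is Hurwitz if all its eigenvalues have negative real part. For symmetric matrices, $A\prec C$ means $C-A$ is positive definite. An equilibrium of a differential-algebraic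 system is locally exponentially stable if there are $\delta,c,\lambda>0$ such that from every initial condition satisfying the algebraic equations and at distance less than $\delta$ from the equilibrium there is a unique continuous solution for all $t\ge0$, and its distance to the equilibrium at time $t$ is at most $c\,e^{-\lambda t}$ times the initial distance. *)

(* Defs.v *)
From HB Require Import structures.
From mathcomp Require Import all_boot all_order all_algebra.
From mathcomp Require Import complex.
From mathcomp Require Import all_classical all_reals all_analysis.

Set Implicit Arguments.
Unset Strict Implicit.
Unset Printing Implicit Defensive.

Import Order.TTheory GRing.Theory Num.Theory.
Import numFieldNormedType.Exports.

Local Open Scope classical_set_scope.
Local Open Scope ring_scope.

Definition dgm (R : realType) (N : nat) (x : 'cV[R]_N) : 'M[R]_N :=
  diag_mx x^T.

Definition pos_vec (R : realType) (N : nat) (x : 'cV[R]_N) : Prop :=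
  forall i, 0 < x i 0.

Definition neg_vec (R : realType) (N : nat) (x : 'cV[R]_N) : Prop :=
  forall i, x i 0 < 0.

(* The eigenvalues are those of A seen as a matrix over R[i]. *)
Definition hurwitz (R : realType) (N : nat) (A : 'M[R]_N) : Prop :=
  forall z : R[i],
    eigenvalue (map_mx (real_complex R) A) z -> complex.Re z < 0.

(* A \prec C; meant for symmetric A and C. *)
Definition mx_prec (R : realType) (N : nat) (A C : 'M[R]_N) : Prop :=
  forall x : 'cV[R]_N, x != 0 -> 0 < (x^T *m (C - A) *m x) 0 0.

(* Matrix of partial derivatives d f_i / d x_j at x; the library's 'J is for
   row vectors. *)
Definition jac (R : realType) (N M : nat) (f : 'cV[R]_N -> 'cV[R]_M)
    (x : 'cV[R]_N) : 'M[R]_(M, N) :=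
  \matrix_(i, j) 'D_(delta_mx j 0) (fun y : 'cV[R]_N => f y i 0) x.

(* C^oo on the half-line of positive voltage magnitudes. *)
Definition smooth_pos (R : realType) (f : R -> R) : Prop :=
  forall (k : nat) (x : R), 0 < x -> derivable (derive1n k f) x 1.

Definition connected_graph (N : nat) (e : rel 'I_N) : Prop :=
  [/\ symmetric e, irreflexive e & forall i j : 'I_N, connect e i j].

Definition susceptance_matrix (R : realType) (N : nat) (e : rel 'I_N)
    (B : 'M[R]_N) : Prop :=
  [/\ forall i j : 'I_N, B i j = B j i,
      forall i j : 'I_N, e i j -> 0 < B i j,
      forall i j : 'I_N, i != j -> ~~ e i j -> B i j = 0
    & forall i : 'I_N, B i i = - \sum_(j | j != i) B i j].

(* Buses are indexed by 'I_(n + m): the n loads (lshift) come first, followed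
   by the m inverters (rshift), so the blocks of B are B_LL = ulsubmx B,
   B_LI = ursubmx B, B_IL = dlsubmx B and B_II = drsubmx B. The gains K_i and
   time constants tau_i are given as vectors k and tau: K_I = dgm k and
   tau_I = dgm tau. *)

Definition B_red (R : realType) (n m : nat) (B : 'M[R]_(n + m))
    (k : 'cV[R]_m) : 'M[R]_n :=
  ulsubmx B - ursubmx B *m invmx (drsubmx B + dgm k) *m dlsubmx B.

Definition W1 (R : realType) (n m : nat) (B : 'M[R]_(n + m))
    (k : 'cV[R]_m) : 'M[R]_(n, m) :=
  - invmx (B_red B k) *m ursubmx B *m invmx (drsubmx B + dgm k) *m dgm k.

Definition W2 (R : realType) (n m : nat) (B : 'M[R]_(n + m))
    (k : 'cV[R]_m) : 'M[R]_(m, n + m) :=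
  invmx (drsubmx B + dgm k) *m row_mx (- dlsubmx B) (dgm k).

Definition EL_star (R : realType) (n m : nat) (B : 'M[R]_(n + m))
    (k EIs : 'cV[R]_m) : 'cV[R]_n :=
  W1 B k *m EIs.

Definition QL (R : realType) (n : nat) (Q : 'I_n -> R -> R)
    (EL : 'cV[R]_n) : 'cV[R]_n :=
  \col_i Q i (EL i 0).

Definition reduced_power_flow (R : realType) (n m : nat) (B : 'M[R]_(n + m))
    (k EIs : 'cV[R]_m) (Q : 'I_n -> R -> R) (EL : 'cV[R]_n) : 'cV[R]_n :=
  QL Q EL + dgm EL *m B_red B k *m (EL - EL_star B k EIs).

Definition J_red (R : realType) (n m : nat) (B : 'M[R]_(n + m))
    (k EIs : 'cV[R]_m) (Q : 'I_n -> R -> R) (EL : 'cV[R]_n) : 'M[R]_n :=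
  jac (QL Q) EL + dgm EL *m B_red B k
  + dgm (B_red B k *m (EL - EL_star B k EIs)).

(* Right-hand side of the closed-loop system. *)
Definition closed_loop (R : realType) (n m : nat) (B : 'M[R]_(n + m))
    (k EIs : 'cV[R]_m) (Q : 'I_n -> R -> R) (E : 'cV[R]_(n + m)) :
    'cV[R]_(n + m) :=
  col_mx (QL Q (usubmx E))
         (dgm (dsubmx E) *m dgm k *m (dsubmx E - EIs))
  + dgm E *m B *m E.

(* Continuous solutions on [0, +oo[ of (0, tau_I dE_I/dt) = F E. Only the
   values at t >= 0 matter. The algebraic equations are imposed at every
   t >= 0; the differential ones at t > 0, from which the one-sided equation
   at t = 0 follows by continuity when F is continuous at E 0. *)
Definition dae_solution (R : realType) (n m : nat) (tau : 'cV[R]_m)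
    (F : 'cV[R]_(n + m) -> 'cV[R]_(n + m)) (E : R -> 'cV[R]_(n + m)) : Prop :=
  [/\ {within `[0, +oo[, continuous E},
      forall t : R, 0 <= t -> usubmx (F (E t)) = 0
    & forall t : R, 0 < t ->
        derivable (fun s => dsubmx (E s)) t 1 /\
        col_mx 0 (dgm tau *m derive1 (fun s => dsubmx (E s)) t) = F (E t)].

(* Distances are measured in the max norm of 'cV[R]_(n + m); by equivalence
   of norms the notion does not depend on this choice. *)
Definition locally_exponentially_stable (R : realType) (n m : nat)
    (tau : 'cV[R]_m) (F : 'cV[R]_(n + m) -> 'cV[R]_(n + m))
    (Ebar : 'cV[R]_(n + m)) : Prop :=
  F Ebar = 0 /\
  exists delta c lambda : R,
    [/\ 0 < delta, 0 < c, 0 < lambda &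
        forall E0 : 'cV[R]_(n + m),
          usubmx (F E0) = 0 -> `|E0 - Ebar| < delta ->
          exists E : R -> 'cV[R]_(n + m),
            [/\ dae_solution tau F E, E 0 = E0,
                forall E' : R -> 'cV[R]_(n + m),
                  dae_solution tau F E' -> E' 0 = E0 ->
                  forall t : R, 0 <= t -> E' t = E t
              & forall t : R, 0 <= t ->
                  `|E t - Ebar| <= c * expR (- lambda * t) * `|E0 - Ebar|]].

(* Main.v *)
Require Import Defs.
From HB Require Import structures.
From mathcomp Require Import all_boot all_order all_algebra.
From mathcomp Require Import complex.
From mathcomp Require Import all_classical all_reals all_analysis.
From mathcomp Require Import ring lra.
Import Order.TTheory GRing.Theory Num.Theory.
Import numFieldNormedType.Exports.
Local Open Scope classical_set_scope.
Local Open Scope ring_scope.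
Set Implicit Arguments.
Unset Strict Implicit.

(** The closed loop has, at the equilibrium Ebar = (EL, EI), the Jacobian
    [Ebar] M with M symmetric: M is B plus a diagonal matrix whose load entries
    are q_i = Q_i'(EL_i)/EL_i - Q_i(EL_i)/EL_i^2 and whose inverter entries are
    the gains k_i (jacobianE, load_slopeE). Eliminating the inverter block of M
    gives the Schur complement S = B_red + [q], and J_red = [EL] S (J_redE).

    Since S is symmetric and [EL] is a positive diagonal matrix, J_red is
    Hurwitz exactly when S is negative definite (hurwitz_negdef,
    negdef_hurwitz). The sufficient condition follows at once: if Q_i' <= 0 then
    q_i <= - Q_i/EL_i^2, so B_red below [EL]^-2 [Q_L] makes S negative definite.

    For the stability, the inverter block B_II + K_I of M is negative definite
    because - B is a graph Laplacian and the gains are negative, so S negative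
    definite makes M negative definite (negdef_linearization). The remaining statement is general (linearized_stability): a
    system (0, tau x') = F(E) is locally exponentially stable at a zero Ebar
    where F is strictly differentiable with derivative [P] M, for P > 0 and M
    negative definite. With e = E - Ebar and z its differential part, the
    constraint F_L = 0 and z' = F_I/tau give
      d/dt sum_i (tau_i/P_i) z_i^2 = 2 z . [P_I]^-1 F_I = 2 e . [P]^-1 F
                                   = 2 e . M e + o(|e|^2),
    so this quadratic function of z decays exponentially along every solution
    near Ebar. Strict differentiability and the invertibility of the load block
    of [P] M give, by the contraction principle, the algebraic variables as a
    Lipschitz function of the differential ones; what is left is an ordinary
    differential equation with a Lipschitz right-hand side, solved by Picard
    iteration. The scaling P is Ebar itself; that the inverter voltages are
    positive is a minimum principle (inverter_voltages_gt0). *)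

(** * Dot products and diagonal matrices *)

Section Dot.
Context {R : realType}.

Definition dot {N} (x y : 'cV[R]_N) : R := \sum_i x i 0 * y i 0.

Lemma dotE {N} (x y : 'cV[R]_N) : (x^T *m y) 0 0 = dot x y.
Proof. by rewrite mxE; apply: eq_bigr => i _; rewrite mxE. Qed.

Lemma dotC {N} (x y : 'cV[R]_N) : dot x y = dot y x.
Proof. by apply: eq_bigr => i _; rewrite mulrC. Qed.

Lemma dotDl {N} (x y z : 'cV[R]_N) : dot (x + y) z = dot x z + dot y z.
Proof. by rewrite -big_split; apply: eq_bigr => i _; rewrite mxE mulrDl. Qed.

Lemma dotDr {N} (x y z : 'cV[R]_N) : dot z (x + y) = dot z x + dot z y.
Proof. by rewrite dotC dotDl !(dotC z). Qed.

Lemma dotZl {N} a (x y : 'cV[R]_N) : dot (a *: x) y = a * dot x y.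
Proof. by rewrite mulr_sumr; apply: eq_bigr => i _; rewrite mxE mulrA. Qed.

Lemma dotZr {N} a (x y : 'cV[R]_N) : dot x (a *: y) = a * dot x y.
Proof. by rewrite dotC dotZl dotC. Qed.

Lemma dotNr {N} (x y : 'cV[R]_N) : dot x (- y) = - dot x y.
Proof. by rewrite -scaleN1r dotZr mulN1r. Qed.

Lemma dot0l {N} (x : 'cV[R]_N) : dot 0 x = 0.
Proof. by rewrite -(scale0r x) dotZl mul0r. Qed.

Lemma dot0r {N} (x : 'cV[R]_N) : dot x 0 = 0.
Proof. by rewrite dotC dot0l. Qed.

Lemma dot_mulmx {N M} (A : 'M[R]_(N, M)) x y :
  dot x (A *m y) = dot (A^T *m x) y.
Proof. by rewrite -!dotE trmx_mul trmxK mulmxA. Qed.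

Lemma dot_col_mx {n m} (a c : 'cV[R]_n) (b d : 'cV[R]_m) :
  dot (col_mx a b) (col_mx c d) = dot a c + dot b d.
Proof. by rewrite -!dotE tr_col_mx mul_row_col mxE. Qed.

Lemma dgm_mulE {N} (d x : 'cV[R]_N) i : (dgm d *m x) i 0 = d i 0 * x i 0.
Proof. by rewrite /dgm mul_diag_mx !mxE. Qed.

Lemma tr_dgm {N} (d : 'cV[R]_N) : (dgm d)^T = dgm d.
Proof. by rewrite /dgm tr_diag_mx. Qed.

Lemma dgm_inj {N} (d x : 'cV[R]_N) : pos_vec d -> dgm d *m x = 0 -> x = 0.
Proof.
move=> d0 /colP dx; apply/colP => i; have := dx i.
by rewrite dgm_mulE !mxE => /eqP; rewrite mulf_eq0 gt_eqF ?d0//= => /eqP.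
Qed.

Lemma dgmK {N} (d : 'cV[R]_N) : pos_vec d ->
  dgm d *m dgm (\col_i (d i 0)^-1) = 1%:M.
Proof.
move=> d0; apply/matrixP => i j; rewrite /dgm mul_diag_mx !mxE.
by have [->|] := eqVneq i j; rewrite ?mulr0// !mulr1n divff// gt_eqF.
Qed.

Lemma dgmD {N} (a b : 'cV[R]_N) : dgm (a + b) = dgm a + dgm b.
Proof. by rewrite /dgm !linearD. Qed.

Lemma dgmM {N} (a b : 'cV[R]_N) : dgm a *m dgm b = dgm (\col_i (a i 0 * b i 0)).
Proof.
apply/matrixP => i j; rewrite /dgm mul_diag_mx !mxE.
by have [->|] := eqVneq i j; rewrite ?mulr0n ?mulr0// !mulr1n.
Qed.

Lemma dgm_col_mx {n m} (a : 'cV[R]_n) (b : 'cV[R]_m) :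
  dgm (col_mx a b) = block_mx (dgm a) 0 0 (dgm b).
Proof. by rewrite /dgm tr_col_mx diag_mx_row. Qed.

Lemma dot_ge0 {N} (x : 'cV[R]_N) : 0 <= dot x x.
Proof. by apply: sumr_ge0 => i _; rewrite -expr2 sqr_ge0. Qed.

Lemma dgm_form_gt0 {N} (d x : 'cV[R]_N) :
  pos_vec d -> x != 0 -> 0 < dot x (dgm d *m x).
Proof.
move=> d0 x0; have [i xi0] : exists i, x i 0 != 0.
  apply/existsP; apply: contraNT x0 => /existsPn x0; apply/eqP/colP => i.
  by rewrite [RHS]mxE; apply/eqP; have := x0 i; rewrite negbK.
have ge0 j : 0 <= x j 0 * (dgm d *m x) j 0.
  by rewrite dgm_mulE mulrCA mulr_ge0 ?(ltW (d0 j))// -expr2 sqr_ge0.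
rewrite /dot (bigD1 i)//= ltr_wpDr ?sumr_ge0//.
by rewrite dgm_mulE mulrCA mulr_gt0// -expr2 exprn_even_gt0.
Qed.

Lemma dot_gt0 {N} (x : 'cV[R]_N) : x != 0 -> 0 < dot x x.
Proof.
move=> x0; have /dgm_form_gt0 /(_ x0) : pos_vec (const_mx 1 : 'cV[R]_N).
  by move=> i; rewrite mxE.
rewrite (_ : dgm _ *m x = x)//; apply/colP => i.
by rewrite dgm_mulE mxE mul1r.
Qed.

Lemma ler_coord {N} (x : 'cV[R]_N) i : `|x i 0| <= `|x|.
Proof.
by rewrite [leRHS]/Num.norm /= mx_normrE; apply/bigmax_geP; right; exists (i, 0).
Qed.

Lemma ler_norm_coord {N} (x : 'cV[R]_N) r :
  0 <= r -> (forall i, `|x i 0| <= r) -> `|x| <= r.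
Proof.
move=> r0 xr; rewrite [leLHS]/Num.norm /= mx_normrE; apply/bigmax_leP; split => //= -[i j] _ /=.
by rewrite (ord1 j).
Qed.

Lemma ler_dot_norm {N} (x y : 'cV[R]_N) : `|dot x y| <= N%:R * (`|x| * `|y|).
Proof.
apply: le_trans (ler_norm_sum _ _ _) _.
rewrite -[N in N%:R]card_ord mulr_natl -sumr_const; apply: ler_sum => i _.
by rewrite normrM ler_pM// ler_coord.
Qed.

Lemma ler_norm_dot {N} (x : 'cV[R]_N) : `|x| ^+ 2 <= dot x x.
Proof.
rewrite -(sqr_sqrtr (dot_ge0 x)); rewrite ler_pXn2r ?nnegrE ?sqrtr_ge0//.
apply: ler_norm_coord; first exact: sqrtr_ge0.
move=> i; rewrite -ler_sqr ?nnegrE ?sqrtr_ge0// (sqr_sqrtr (dot_ge0 x)).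
rewrite real_normK ?num_real// /dot (bigD1 i)//= -expr2 lerDl.
by apply: sumr_ge0 => j _; rewrite -expr2 sqr_ge0.
Qed.

Lemma mulmx_norm_bound {N M} (A : 'M[R]_(N, M)) :
  exists2 C, 0 < C & forall x : 'cV[R]_M, `|A *m x| <= C * `|x|.
Proof.
pose C := 1 + \sum_i \sum_j `|A i j|.
have C0 : 0 < C.
  by rewrite ltr_wpDr// sumr_ge0// => i _; rewrite sumr_ge0.
exists C => // x; apply: ler_norm_coord; first by rewrite mulr_ge0// ltW.
move=> i; rewrite mxE (le_trans (ler_norm_sum _ _ _))//.
have -> : \sum_j `|A i j * x j 0| = \sum_j `|A i j| * `|x j 0|.
  by apply: eq_bigr => j _; rewrite normrM.
apply: (@le_trans _ _ ((\sum_j `|A i j|) * `|x|)).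
  by rewrite mulr_suml ler_sum// => j _; rewrite ler_wpM2l// ler_coord.
rewrite ler_wpM2r// /C (bigD1 i)//= addrCA lerDl addr_ge0// sumr_ge0// => j _.
exact: sumr_ge0.
Qed.

End Dot.

(** * Negative definite matrices *)

Section NegativeDefinite.
Context {R : realType}.

Definition negdef {N} (A : 'M[R]_N) :=
  forall x : 'cV[R]_N, x != 0 -> dot x (A *m x) < 0.

Lemma negdef_unit {N} (A : 'M[R]_N) : negdef A -> A \in unitmx.
Proof.
move=> nA; rewrite -unitmx_tr -row_free_unit; apply/row_freeP.
have /eqP : kermx A^T == 0.
  apply/eqP/row_matrixP => i; rewrite row0; apply/eqP; apply: contraT => r0.
  have : row i (kermx A^T) *m A^T = 0 by rewrite -row_mul mulmx_ker row0.
  move=> /(congr1 trmx); rewrite trmx_mul trmxK trmx0 => K0.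
  have := nA (row i (kermx A^T))^T; rewrite K0 dot0r ltxx; apply.
  by apply: contra r0 => /eqP /(congr1 trmx); rewrite trmxK trmx0 => ->.
move=> k0; exists (invmx A^T); rewrite mulmxV//.
by rewrite -row_free_unit -kermx_eq0 k0.
Qed.

Lemma continuous_form {N} (A : 'M[R]_N) :
  continuous (fun v : 'rV[R]_N => dot v^T (A *m v^T)).
Proof.
rewrite /dot.
have -> : (fun v : 'rV[R]_N => \sum_i v^T i 0 * (A *m v^T) i 0) =
  (fun v : 'rV[R]_N => \sum_i v 0 i * \sum_j A i j * v 0 j).
  apply/funext => w; apply: eq_bigr => i _; rewrite !mxE; congr (_ * _).
  by apply: eq_bigr => j _; rewrite mxE.
apply: continuous_big => [|i _]; first exact: add_continuous.
have cc j : continuous (fun w : 'rV[R]_N => w 0 j) by exact: coord_continuous.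
move=> v; apply: continuousM; first exact: cc.
move: v; apply: continuous_big => [|j _]; first exact: add_continuous.
by move=> v; apply: continuousM; [exact: cst_continuous|exact: cc].
Qed.

(** The quotient of the two forms is invariant under scaling, so its maximum on
    the compact unit sphere is a maximum everywhere. *)
Lemma rayleigh_max {N} (A : 'M[R]_N) (d : 'cV[R]_N) : (0 < N)%N -> pos_vec d ->
  exists lam (x : 'cV[R]_N), [/\ x != 0,
    dot x (A *m x) = lam * dot x (dgm d *m x) &
    forall y, dot y (A *m y) <= lam * dot y (dgm d *m y)].
Proof.
move=> N0 d0.
pose S := [set v : 'rV[R]_N | `|v| = 1].
pose f (v : 'rV[R]_N) := dot v^T (A *m v^T) / dot v^T (dgm d *m v^T).
have S0 v : v != 0 -> S (`|v|^-1 *: v).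
  by move=> v0; rewrite /S/= normrZ normfV normr_id mulVf// normr_eq0.
have nz (v : 'rV[R]_N) : S v -> v^T != 0.
  move=> v1; apply/negP => /eqP /(congr1 trmx); rewrite trmxK trmx0 => v0.
  by move: v1; rewrite /S/= v0 normr0 => /eqP; rewrite eq_sym oner_eq0.
have [] := @EVT_max_rV R N f S.
- exists (`|const_mx 1 : 'rV[R]_N|^-1 *: const_mx 1); apply: S0.
  apply/eqP => /matrixP /(_ 0 (Ordinal N0)); rewrite !mxE => /eqP.
  by rewrite oner_eq0.
- apply: bounded_closed_compact.
    by exists 1; split => // M M1 v /= ->; exact: ltW.
  apply: (@preimage_closed _ _ (fun v : 'rV[R]_N => `|v|) [set x | x = 1]).
    by move=> ? _; exact: norm_continuous.
  exact: closed_eq.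
- apply/continuous_in_subspaceT => v /set_mem vS.
  rewrite /f; apply: (@continuousM _ _ (fun w : 'rV[R]_N => dot w^T (A *m w^T))
    (fun w => (dot w^T (dgm d *m w^T))^-1)); first exact: continuous_form.
  apply: continuousV; last exact: continuous_form.
  by rewrite gt_eqF// dgm_form_gt0// nz.
move=> c /set_mem cS cmax; exists (f c), c^T; split; first exact: nz.
  by rewrite /f divfK// gt_eqF// dgm_form_gt0// nz.
move=> y; have [->|y0] := eqVneq y 0; first by rewrite !dot0l mulr0.
rewrite -ler_pdivrMr ?dgm_form_gt0//.
have yT0 : y^T != 0.
  by apply: contra y0 => /eqP /(congr1 trmx); rewrite trmxK trmx0 => ->.
have := cmax (`|y^T|^-1 *: y^T) (mem_set (S0 _ yT0)).
rewrite /f linearZ/= trmxK -!scalemxAr !dotZl !dotZr !mulrA => h; apply: le_trans h.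
have s0 : `|y^T|^-1 * `|y^T|^-1 != 0 by rewrite mulf_neq0// invr_eq0 normr_eq0.
by rewrite -mulf_div divff// mul1r.
Qed.

Lemma negdef_coercive {N} (A : 'M[R]_N) : negdef A ->
  exists2 mu, 0 < mu & forall x, dot x (A *m x) <= - mu * dot x x.
Proof.
case: (posnP N) => [N0|N0 nA].
  move=> _; exists 1 => // x; have -> : x = 0.
    by apply/colP => -[k k_lt]; exfalso; rewrite N0 in k_lt.
  by rewrite !dot0l mulr0.
have [|lam [x [x0 xlam le]]] := @rayleigh_max N A (const_mx 1) N0.
  by move=> i; rewrite mxE.
have dE (z : 'cV[R]_N) : dgm (const_mx 1) *m z = z.
  by apply/colP => i; rewrite dgm_mulE mxE mul1r.
exists (- lam); last by move=> y; have := le y; rewrite opprK dE.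
rewrite oppr_gt0 -(pmulr_llt0 _ (dot_gt0 x0)).
by move: xlam; rewrite dE => <-; exact: nA.
Qed.

(** A zero of a nonnegative quadratic form is a minimum, hence a critical point.
    Concretely, the form is negative at x - t P x for small t > 0 unless
    P x = 0. *)
Lemma psd_null {N} (P : 'M[R]_N) x : P^T = P ->
  (forall y, 0 <= dot y (P *m y)) -> dot x (P *m x) = 0 -> P *m x = 0.
Proof.
move=> PT ge0 x0; apply/eqP; apply: contraT => /dot_gt0 s0.
set s := dot _ _ in s0.
pose c := dot (P *m x) (P *m (P *m x)); have c0 : 0 <= c := ge0 _.
have xs : dot x (P *m (P *m x)) = s by rewrite dot_mulmx PT.
(* Along this line the form is - 2 t s + t^2 c; t = s/(c + 1) makes it
   negative. *)
have := ge0 (x + (- (s / (c + 1))) *: (P *m x)).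
rewrite mulmxDr -scalemxAr !dotDl !dotDr !dotZl !dotZr x0 xs -/s -/c.
have c1 : c + 1 != 0 by rewrite gt_eqF// ltr_wpDl.
rewrite (_ : _ + _ = - (s ^+ 2 * (c + 2) / (c + 1) ^+ 2)); last by field.
rewrite oppr_ge0 leNgt divr_gt0//; first by rewrite mulr_gt0 ?exprn_gt0// ltr_wpDl.
by rewrite exprn_gt0// ltr_wpDl.
Qed.

End NegativeDefinite.

(** * Positive diagonal times symmetric: Hurwitz means negative definite *)

Section Hurwitz.
Context {R : realType}.

Let Re_mulmx {N M} (v : 'rV[R[i]]_N) (A : 'M[R]_(N, M)) :
  map_mx (@complex.Re R) (v *m map_mx (real_complex R) A) = map_mx (@complex.Re R) v *m A.
Proof.
apply/matrixP => i j; rewrite !mxE raddf_sum; apply: eq_bigr => k _.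
by rewrite !mxE; case: (v i k) => a b /=; rewrite mulr0 subr0.
Qed.

Let Im_mulmx {N M} (v : 'rV[R[i]]_N) (A : 'M[R]_(N, M)) :
  map_mx (@complex.Im R) (v *m map_mx (real_complex R) A) = map_mx (@complex.Im R) v *m A.
Proof.
apply/matrixP => i j; rewrite !mxE raddf_sum; apply: eq_bigr => k _.
by rewrite !mxE; case: (v i k) => a b /=; rewrite mulr0 add0r.
Qed.

(** If v = a + i b is a left eigenvector of D S for z, with D the diagonal
    factor, then summing the S-forms of D a and D b cancels the imaginary part
    of z and leaves Re z times the positive number a . D a + b . D b. *)
Lemma negdef_hurwitz {N} (d : 'cV[R]_N) (S : 'M[R]_N) :
  pos_vec d -> S^T = S -> negdef S -> hurwitz (dgm d *m S).
Proof.
move=> d0 ST nS z /eigenvalueP[v vz v0].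
pose a := (map_mx (@complex.Re R) v)^T; pose b := (map_mx (@complex.Im R) v)^T.
have Sa : S *m (dgm d *m a) = complex.Re z *: a - complex.Im z *: b.
  apply: trmx_inj; rewrite !trmx_mul ST tr_dgm trmxK -mulmxA -Re_mulmx vz.
  by apply/matrixP => i j; rewrite !mxE; case: (v _ _) (z) => ? ? [].
have Sb : S *m (dgm d *m b) = complex.Im z *: a + complex.Re z *: b.
  apply: trmx_inj; rewrite !trmx_mul ST tr_dgm trmxK -mulmxA -Im_mulmx vz.
  apply/matrixP => i j; rewrite !mxE; case: (v _ _) (z) => ? ? [] ? ? /=.
  by rewrite addrC.
have le0 (x : 'cV[R]_N) : 0 <= dot x (dgm d *m x).
  by have [->|x0] := eqVneq x 0; rewrite ?dot0l// ltW// dgm_form_gt0.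
have nS0 (x : 'cV[R]_N) : dot x (S *m x) <= 0.
  by have [->|x0] := eqVneq x 0; rewrite ?dot0l// ltW// nS.
have ab : a != 0 \/ b != 0.
  have [a0|] := eqVneq a 0; [right|by left].
  apply: contra v0 => /eqP b0; apply/eqP/rowP => i.
  move/colP: a0 => /(_ i); move/colP: b0 => /(_ i); rewrite !mxE.
  by case: (v 0 i) => ? ? /= -> ->.
have lt0 : dot (dgm d *m a) (S *m (dgm d *m a)) +
    dot (dgm d *m b) (S *m (dgm d *m b)) < 0.
  have dnz (x : 'cV[R]_N) : x != 0 -> dgm d *m x != 0.
    by move=> x0; apply: contra x0 => /eqP /(dgm_inj d0)/eqP.
  case: ab => [/dnz/nS h|/dnz/nS h].
    by have := ltr_leD h (nS0 (dgm d *m b)); rewrite addr0.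
  by have := ler_ltD (nS0 (dgm d *m a)) h; rewrite addr0.
have gt0 : 0 < dot a (dgm d *m a) + dot b (dgm d *m b).
  case: ab => [h|h]; [apply: ltr_wpDr|apply: ltr_wpDl] => //;
  exact: dgm_form_gt0.
have sym : dot (dgm d *m b) a = dot (dgm d *m a) b.
  by rewrite dotC dot_mulmx tr_dgm.
move: lt0; rewrite Sa Sb !dotDr dotNr !dotZr sym.
rewrite (dotC _ a) (dotC _ b) => lt0.
rewrite -(pmulr_llt0 _ gt0); apply: le_lt_trans lt0; rewrite le_eqVlt; apply/orP; left.
by apply/eqP; rewrite (dotC _ b); ring.
Qed.

(** The maximum lam of the Rayleigh quotient of S relative to D^-1, with D the
    diagonal factor, is attained at some x with S x = lam D^-1 x; the transpose
    of D^-1 x is then a left eigenvector of D S for lam. If S is not negative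
    definite, lam >= 0. *)
Lemma hurwitz_negdef {N} (d : 'cV[R]_N) (S : 'M[R]_N) :
  pos_vec d -> S^T = S -> hurwitz (dgm d *m S) -> negdef S.
Proof.
move=> d0 ST hS x1 x10; rewrite ltNge; apply/negP => x1S.
have N0 : (0 < N)%N.
  case: (posnP N) => // N0; move: x10 => /eqP[]; apply/colP => -[k k_lt].
  by exfalso; rewrite N0 in k_lt.
pose e : 'cV[R]_N := \col_i (d i 0)^-1.
have e0 : pos_vec e by move=> i; rewrite mxE invr_gt0.
have [lam [x [x0 xlam le]]] := rayleigh_max S N0 e0.
have lam0 : 0 <= lam.
  by rewrite -(pmulr_lge0 _ (dgm_form_gt0 e0 x10)) (le_trans x1S).
have Sx : S *m x = lam *: (dgm e *m x).
  apply/esym/eqP; rewrite -subr_eq0 scalemxAl -mulmxBl; apply/eqP.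
  apply: psd_null.
  - by rewrite linearB linearZ/= tr_dgm ST.
  - by move=> y; rewrite mulmxBl -scalemxAl dotDr dotNr dotZr subr_ge0.
  - by rewrite mulmxBl -scalemxAl dotDr dotNr dotZr xlam subrr.
pose v := (dgm e *m x)^T.
have vS : v *m (dgm d *m S) = lam *: v.
  rewrite /v trmx_mul tr_dgm mulmxA -(mulmxA x^T).
  rewrite -[dgm e *m _]trmxK trmx_mul !tr_dgm dgmK// trmx1 mulmx1.
  by rewrite -[S]ST -trmx_mul Sx linearZ/= trmx_mul tr_dgm.
have /hS /= : eigenvalue (map_mx (real_complex R) (dgm d *m S)) (real_complex R lam).
  apply/eigenvalueP; exists (map_mx (real_complex R) v).
    by rewrite -map_mxM vS map_mxZ.
  rewrite map_mx_eq0 /v; apply: contra x0 => /eqP /(congr1 trmx).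
  by rewrite trmxK trmx0 => /(dgm_inj e0)/eqP.
by rewrite ltNge lam0.
Qed.
End Hurwitz.

(** * Norms of block vectors and diagonal forms *)

Section Blocks.
Context {R : realType}.

Lemma ler_usubmx {n m} (E : 'cV[R]_(n + m)) : `|usubmx E| <= `|E|.
Proof. by apply: ler_norm_coord => // i; rewrite mxE ler_coord. Qed.

Lemma ler_dsubmx {n m} (E : 'cV[R]_(n + m)) : `|dsubmx E| <= `|E|.
Proof. by apply: ler_norm_coord => // i; rewrite mxE ler_coord. Qed.

Lemma ler_col_mx {n m} (y : 'cV[R]_n) (x : 'cV[R]_m) r :
  `|y| <= r -> `|x| <= r -> `|col_mx y x| <= r.
Proof.
move=> yr xr; apply: ler_norm_coord => [|i]; first exact: le_trans yr.
rewrite mxE; case: (fintype.split i) => j; [exact: le_trans (ler_coord _ _) yr|].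
exact: le_trans (ler_coord _ _) xr.
Qed.

Lemma ler_norm_sub_mx {n m} (E : 'cV[R]_(n + m)) :
  `|E| <= `|usubmx E| + `|dsubmx E|.
Proof. by rewrite -{1}(vsubmxK E) ler_col_mx// ?lerDl ?lerDr. Qed.

Lemma dgm_form_bounds {N} (w : 'cV[R]_N) : pos_vec w ->
  exists a b, [/\ 0 < a, 0 < b, forall z : 'cV[R]_N, a * `|z| ^+ 2 <= dot z (dgm w *m z),
    forall z, dot z (dgm w *m z) <= b * dot z z &
    forall z, dot z (dgm w *m z) <= b * `|z| ^+ 2].
Proof.
move=> w0.
have [a a0 aP] : exists2 mu, 0 < mu & forall x, dot x (- dgm w *m x) <= - mu * dot x x.
  apply: negdef_coercive => x x0.
  by rewrite mulNmx dotNr oppr_lt0 dgm_form_gt0.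
have [C C0 CP] := mulmx_norm_bound (dgm w).
have bP z : dot z (dgm w *m z) <= (N%:R * C + 1) * `|z| ^+ 2.
  apply: le_trans (ler_norm _) _; apply: le_trans (ler_dot_norm _ _) _.
  rewrite mulrDl mul1r ler_wpDr ?sqr_ge0// -mulrA ler_wpM2l// expr2 mulrCA.
  by rewrite ler_wpM2l.
exists a, (N%:R * C + 1); split => //.
- by rewrite ltr_wpDl// mulr_ge0// ltW.
- move=> z; have := aP z; rewrite mulNmx dotNr mulNr lerN2; apply: le_trans.
  by rewrite ler_wpM2l ?ler_norm_dot// ltW.
- move=> z; apply: le_trans (bP z) _; rewrite ler_wpM2l ?ler_norm_dot//.
  by rewrite addr_ge0// mulr_ge0// ltW.
Qed.

End Blocks.

(** * Differential inequalities and primitives *)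

Section Calculus.
Context {R : realType}.

Lemma is_derive_expRM (a t : R) :
  is_derive t 1 (fun s => expR (a * s)) (a * expR (a * t)).
Proof.
have h : is_derive t 1 ( *%R a) a.
  by apply: is_derive_eq; rewrite [LHS]mulr1.
have := @is_derive1_comp _ expR ( *%R a) t _ _ (is_derive_expR _) h.
by move=> g; apply: (is_derive_eq g); rewrite mulrC.
Qed.

Lemma continuous_expRM (a : R) : continuous (fun s : R => expR (a * s)).
Proof.
move=> t; apply/differentiable_continuous/derivable1_diffP.
by have [] := is_derive_expRM a t.
Qed.

Lemma nonincreasing_of_deriv (f df : R -> R) (T : R) : 0 <= T ->
  {within `[0, T], continuous f} ->
  (forall t : R, 0 < t < T -> is_derive t 1 f (df t)) ->
  (forall t : R, 0 < t < T -> df t <= 0) -> f T <= f 0.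
Proof.
move=> T0 cf fd df0; have [->//|Tn0] := eqVneq T 0.
have Tgt0 : 0 < T by rewrite lt_neqAle eq_sym Tn0.
have fd' x : x \in `]0, T[%R -> is_derive x 1 f (df x) by rewrite in_itv/= => /fd.
have [c cT] := MVT Tgt0 fd' cf.
rewrite subr0 => /eqP; rewrite subr_eq => /eqP ->.
rewrite in_itv/= in cT.
by rewrite gerDr mulr_le0_ge0// df0.
Qed.

(** The function f(t) e^(-a t) is nonincreasing. *)
Lemma gronwall (f df : R -> R) (a T : R) : 0 <= T ->
  {within `[0, T], continuous f} ->
  (forall t : R, 0 < t < T -> is_derive t 1 f (df t)) ->
  (forall t : R, 0 < t < T -> df t <= a * f t) -> f T <= f 0 * expR (a * T).
Proof.
move=> T0 cf fd dfa.
have := @nonincreasing_of_deriv (fun t => f t * expR (- a * t))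
  (fun t => (df t - a * f t) * expR (- a * t)) T T0.
rewrite mulr0 expR0 mulr1 mulNr expRN ler_pdivrMr ?expR_gt0//; apply.
- move=> t; apply: (@continuousM R (subspace `[0, T]) f (fun s => expR (- a * s)) t).
    exact: cf.
  by have := @continuous_subspaceT _ _ `[0, T] _ (continuous_expRM (a := - a)); exact.
- move=> t tT; have := is_derive_expRM (- a) t.
  have ft := fd t tT => et.
  have h := is_deriveM ft et; apply: (is_derive_eq h).
  by rewrite /GRing.scale/=; ring.
- by move=> t tT; rewrite mulr_le0_ge0 ?expR_ge0// subr_le0 dfa.
Qed.

Lemma ler_deriv (u du v dv : R -> R) (T : R) : 0 <= T ->
  {within `[0, T], continuous u} -> {within `[0, T], continuous v} ->
  (forall t : R, 0 < t < T -> is_derive t 1 u (du t)) ->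
  (forall t : R, 0 < t < T -> is_derive t 1 v (dv t)) ->
  (forall t : R, 0 < t < T -> `|du t| <= dv t) -> `|u T - u 0| <= v T - v 0.
Proof.
move=> T0 cu cv ud vd duv.
have h1 := @nonincreasing_of_deriv (u - v) (du - dv) T T0.
have h2 := @nonincreasing_of_deriv (- u - v) (- du - dv) T T0.
have : (u - v) T <= (u - v) 0.
  apply: h1.
  - by move=> t; apply: (@continuousB _ _ (subspace `[0, T]) u v); [exact: cu|exact: cv].
  - by move=> t tT; have ? := ud t tT; have ? := vd t tT; exact: is_deriveB.
  - by move=> t /duv; rewrite ler_norml subr_le0 => /andP[].
have : (- u - v) T <= (- u - v) 0.
  apply: h2.
  - move=> t; apply: (@continuousB _ _ (subspace `[0, T]) (- u) v); last exact: cv.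
    by apply: (@continuousN _ _ (subspace `[0, T]) u); exact: cu.
  - move=> t tT; have h := ud t tT; have ? := vd t tT.
    have ? := is_deriveN h; exact: is_deriveB.
  - by move=> t /duv; rewrite ler_norml subr_le0 lerNl => /andP[].
rewrite -[(- u - v) T]/(- u T - v T) -[(- u - v) 0]/(- u 0 - v 0).
rewrite -[(u - v) T]/(u T - v T) -[(u - v) 0]/(u 0 - v 0).
by move=> ? ?; rewrite ler_norml; apply/andP; split; lra.
Qed.

(** The integral starts at -1, so that 0 is interior and the primitive has a
    two-sided derivative there as well. *)
Lemma exists_primitive (g : R -> R) : continuous g ->
  exists2 P : R -> R, P 0 = 0 & forall t : R, 0 <= t -> is_derive t 1 P (g t).
Proof.
move=> cg.
pose F t := (\int[lebesgue_measure]_(s in `[-1, t]) g s)%R.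
exists (fun t => F t - F 0); first by rewrite subrr.
move=> t t0.
have [||| |dF F'] := @continuous_FTC1_closed R g (-1) t (t + 1).
- by rewrite ltrDl.
- apply: continuous_compact_integrable; first exact: segment_compact.
  exact: continuous_subspaceT.
- by rewrite (lt_le_trans _ t0)// oppr_lt0.
- exact: cg.
have dFt : is_derive t 1 F (g t).
  by split; [exact: dF|rewrite -derive1E F'].
have := is_deriveB dFt (is_derive_cst (F 0) t 1).
by rewrite subr0.
Qed.

Lemma continuous_max0 : continuous (fun t : R => Num.max t 0).
Proof. by move=> t; apply: continuous_max; [exact: cvg_id|exact: cvg_cst]. Qed.

Lemma exists_geometric_lt (K e : R) : 0 <= K -> 0 < e -> exists k, K / 2 ^+ k < e.
Proof.
move=> K0 e0; have Ke0 : 0 <= K / e by rewrite divr_ge0// ltW.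
exists (Num.bound (K / e)); rewrite ltr_pdivrMr ?exprn_gt0// mulrC -ltr_pdivrMr//.
apply: lt_le_trans (archi_boundP Ke0) _.
by rewrite -natrX ler_nat ltnW// ltn_expl.
Qed.

Lemma continuous_colP {T : topologicalType} {m} (x : T -> 'cV[R]_m) :
  (forall i, continuous (fun t => x t i 0)) -> continuous x.
Proof.
move=> cx t; apply/cvgrPdist_le => e e0.
near=> s; apply: ler_norm_coord; first exact: ltW.
move=> i; rewrite !mxE; move: i; near: s; apply: filter_forall => i.
by have /cvgrPdist_le := cx i t; apply.
Unshelve. all: by end_near. Qed.

End Calculus.

(** * Trapping, and quadratic functions along curves *)

Section Curves.
Context {R : realType}.

Lemma within_dist {V : normedModType R} (f : R -> V) (s e : R) :
  {within `[0, +oo[, continuous f} -> 0 <= s -> 0 < e ->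
  exists2 d, 0 < d & forall t, 0 <= t -> `|s - t| < d -> `|f s - f t| < e.
Proof.
move=> /subspace_continuousP cf s0 e0.
have /cf /cvgrPdist_lt /(_ e e0) : `[0, +oo[%classic s by rewrite /= in_itv/= andbT.
move=> /nbhs_ballP[d d0 dP]; exists d => // t t0 st; apply: dP => //=.
by rewrite in_itv/= andbT.
Qed.

(** A continuity argument at the first time c when N reaches rho: N <= rho up to
    and including c, so the hypothesis gives N c < rho, a contradiction. *)
Lemma trapping (N : R -> R) (rho : R) :
  {within `[0, +oo[, continuous N} -> N 0 < rho ->
  (forall T : R, 0 <= T -> (forall t, 0 <= t <= T -> N t <= rho) -> N T < rho) ->
  forall t : R, 0 <= t -> N t <= rho.
Proof.
move=> cN N0 stepN t0 t0_ge0; rewrite leNgt; apply/negP => Nt0.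
pose D := [set t : R | 0 <= t /\ rho <= N t].
have hD : has_inf D.
  by split; [exists t0; split => //; exact: ltW|exists 0 => t []].
pose c := inf D.
have c0 : 0 <= c by apply: lb_le_inf; [case: hD|move=> t []].
have lec t : 0 <= t -> t < c -> N t < rho.
  move=> t_ge0; rewrite ltNge; apply: contraNlt => Nt.
  by apply: ge_inf; [case: hD|split].
have geNc : rho <= N c.
  rewrite leNgt; apply/negP => Nc.
  have e0 : 0 < rho - N c by rewrite subr_gt0.
  have [d d0 dP] := within_dist cN c0 e0.
  have [t [t_ge0 Nt] tcd] := inf_adherent d0 hD.
  have tc : c <= t by apply: ge_inf; [case: hD|split].
  have := dP t t_ge0; rewrite distrC ger0_norm ?subr_ge0// ltrBlDl => /(_ tcd).
  rewrite distrC ltr_norml => /andP[_]; rewrite ltrBlDr subrK.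
  by rewrite ltNge Nt.
have c_gt0 : 0 < c.
  rewrite lt_neqAle c0 andbT; apply/negP => /eqP c00.
  by move: N0; rewrite c00 ltNge geNc.
have leNc : N c <= rho.
  rewrite leNgt; apply/negP => Nc.
  have e0 : 0 < N c - rho by rewrite subr_gt0.
  have [d d0 dP] := within_dist cN c0 e0.
  pose t := c - Num.min (d / 2) c.
  have m0 : 0 < Num.min (d / 2) c by rewrite lt_min c_gt0 divr_gt0.
  have t_ge0 : 0 <= t by rewrite subr_ge0 ge_min lexx orbT.
  have tc : t < c by rewrite ltrBlDr ltrDl.
  have := dP t t_ge0; rewrite /t subKr ger0_norm ?(ltW m0)// => h.
  have : `|N c - N t| < N c - rho.
    by apply: h; rewrite gt_min ltr_pdivrMr// ltr_pMr// ltr1n.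
  rewrite ltr_norml => /andP[_]; rewrite ltrD2l ltrN2 => /ltW.
  by rewrite leNgt lec.
have := stepN c c0; rewrite ltNge geNc => h.
suff : false by []; apply: h => t /andP[t_ge0].
by rewrite le_eqVlt => /predU1P[->//|/lec h]; exact/ltW/h.
Qed.

Lemma is_derive_weighted_squares {m} (w : 'I_m -> R) (z : 'I_m -> R -> R) (dz : 'I_m -> R) (t : R) :
  (forall i, is_derive t 1 (z i) (dz i)) ->
  is_derive t 1 (fun s => \sum_i w i * (z i s * z i s))
    (2 * \sum_i w i * (z i t * dz i)).
Proof.
move=> zd.
have h i : is_derive t 1 (w i \*: (z i * z i)) (2 * (w i * (z i t * dz i))).
  have := is_deriveZ (w i) (is_deriveM (zd i) (zd i)) => h.
  by apply: (is_derive_eq h); rewrite /GRing.scale/=; ring.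
have := is_derive_sum h; rewrite -mulr_sumr => hs.
rewrite [X in is_derive _ _ X _](_ : _ = \sum_(i < m) (w i \*: (z i * z i)))//.
by apply/funext => s; rewrite fct_sumE.
Qed.

Lemma within_continuous_weighted_squares {n m : nat} (w : 'I_m -> R)
    (E E' : R -> 'cV[R]_(n + m)) (A : set R) :
  {within A, continuous E} -> {within A, continuous E'} ->
  {within A, continuous (fun s => \sum_i w i *
    ((dsubmx (E s) i 0 - dsubmx (E' s) i 0) * (dsubmx (E s) i 0 - dsubmx (E' s) i 0)))}.
Proof.
move=> cE cE'.
have cc (G : R -> 'cV[R]_(n + m)) i : {within A, continuous G} ->
    {within A, continuous (fun s => dsubmx (G s) i 0)}.
  move=> cG t.
  rewrite (_ : (fun s => dsubmx (G s) i 0) = (fun s => G s (rshift n i) 0)).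
    apply: (@continuous_comp (subspace A) _ _ G (fun v : 'cV[R]_(n + m) => v (rshift n i) 0)).
      exact: cG.
    exact: coord_continuous.
  by apply/funext => s; rewrite mxE.
apply: (@continuous_big _ _ _ _ _ _ (subspace A)) => [|i _]; first exact: add_continuous.
have cd : {within A, continuous (fun s => dsubmx (E s) i 0 - dsubmx (E' s) i 0)}.
  by move=> t; apply: (@continuousB _ _ (subspace A) (fun s => dsubmx (E s) i 0)
    (fun s => dsubmx (E' s) i 0)); exact: cc.
move=> t; apply: (@continuousM R (subspace A) (fun=> w i) (fun s =>
    (dsubmx (E s) i 0 - dsubmx (E' s) i 0) * (dsubmx (E s) i 0 - dsubmx (E' s) i 0))).
  exact: cst_continuous.
by apply: (@continuousM R (subspace A) (fun s => dsubmx (E s) i 0 - dsubmx (E' s) i 0)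
  (fun s => dsubmx (E s) i 0 - dsubmx (E' s) i 0)); exact: cd.
Qed.

End Curves.

(** * Ordinary differential equations with Lipschitz right-hand side *)

Section Picard.
Context {R : realType} {m : nat}.

Lemma lipschitz_continuous {p q : nat} (G : 'cV[R]_p -> 'cV[R]_q) L : 0 < L ->
  (forall x y, `|G x - G y| <= L * `|x - y|) -> continuous G.
Proof.
move=> L0 GL x; apply/(@cvgrPdist_le _ _ _ (nbhs x) _ G (G x)) => e e0.
have d0 : 0 < L^-1 * e by rewrite mulr_gt0// invr_gt0.
have : nbhs x (ball x (L^-1 * e)) by exact: nbhsx_ballx.
apply: filterS => y; rewrite -ball_normE/= => xy.
by apply: le_trans (GL _ _) _; rewrite -ler_pdivlMl// ltW.
Qed.

Variables (G : 'cV[R]_m -> 'cV[R]_m) (L : R) (x0 : 'cV[R]_m).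
Hypotheses (L0 : 0 < L) (GL : forall x y, `|G x - G y| <= L * `|x - y|).

(** y is the image of x under the Picard operator: y(t) = x0 + the integral of
    G(x(s)) for s between 0 and t. *)
Let picard_image (x y : R -> 'cV[R]_m) := [/\ continuous y, y 0 = x0 &
  forall t : R, 0 < t -> forall i, is_derive t 1 (fun s => y s i 0) (G (x t) i 0)].

Lemma picard_step (x : R -> 'cV[R]_m) : continuous x -> exists y, picard_image x y.
Proof.
move=> cx.
have cG i : continuous (fun t => G (x t) i 0).
  move=> t; apply: (@continuous_comp _ _ _ (G \o x) (fun v : 'cV[R]_m => v i 0)).
    by apply: continuous_comp; [exact: cx|exact: lipschitz_continuous L0 GL _].
  exact: coord_continuous.
have [P PE] := choice (fun i => let: ex_intro2 P P0 Pd := exists_primitive (cG i) in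
  ex_intro _ P (conj P0 Pd)).
(* The primitives are controlled for t >= 0 only; freezing the curve for t < 0
   makes it continuous on the whole line. *)
exists (fun t => \col_i (x0 i 0 + P i (Num.max t 0))); split.
- apply: continuous_colP => i.
  rewrite (_ : (fun t => _) = (fun t : R => x0 i 0 + P i (Num.max t 0))); last first.
    by apply/funext => t; rewrite mxE.
  move=> t; apply: continuousD; first exact: cst_continuous.
  apply: (@continuous_comp _ _ _ (fun t : R => Num.max t 0) (P i)).
    exact: continuous_max0.
  have [_ /(_ (Num.max t 0))] := PE i; rewrite le_max lexx orbT => /(_ isT) [dP _].
  by apply/differentiable_continuous/derivable1_diffP.
- by apply/colP => i; rewrite mxE maxxx; have [-> _] := PE i; rewrite addr0.
- move=> t t0 i; have [_ /(_ t (ltW t0)) Pd] := PE i.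
  have := is_deriveD (is_derive_cst (x0 i 0) t 1) Pd; rewrite add0r.
  apply: near_eq_is_derive; near=> s; rewrite !mxE max_l//.
  by near: s; apply: filterS (lt_nbhsr t0) => s /ltW.
Unshelve. all: by end_near. Qed.

Lemma ler_dist_curves (y y' g g' : R -> 'cV[R]_m) (a K : R) : 0 <= K ->
  continuous y -> continuous y' -> y 0 = y' 0 ->
  (forall t : R, 0 < t -> forall i, is_derive t 1 (fun s => y s i 0) (g t i 0)) ->
  (forall t : R, 0 < t -> forall i, is_derive t 1 (fun s => y' s i 0) (g' t i 0)) ->
  (forall t : R, 0 <= t -> `|g t - g' t| <= K * (a * expR (a * t))) ->
  forall t : R, 0 <= t -> `|y t - y' t| <= K * expR (a * t).
Proof.
move=> K0 cy cy' yy' dy dy' gK T T0.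
apply: ler_norm_coord; first by rewrite mulr_ge0 ?expR_ge0.
move=> i; rewrite !mxE.
have cc (z : R -> 'cV[R]_m) : continuous z -> continuous (fun t => z t i 0).
  move=> cz t; apply: (@continuous_comp _ _ _ z (fun v : 'cV[R]_m => v i 0)).
    exact: cz.
  exact: coord_continuous.
pose u (t : R) := y t i 0 - y' t i 0.
pose v (t : R) := K * expR (a * t).
have := @ler_deriv R u (fun t => g t i 0 - g' t i 0) v
  (fun t => K * (a * expR (a * t))) T T0.
have u0 : u 0 = 0 by rewrite /u yy' subrr.
rewrite u0 subr0 => h.
apply: le_trans (h _ _ _ _ _) _.
- by apply: continuous_subspaceT => t; apply: continuousB; exact: cc.
- apply: continuous_subspaceT => t.
  apply: (@continuousM R R (fun=> K) (fun s => expR (a * s)) t).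
    exact: cst_continuous.
  exact: continuous_expRM.
- by move=> t /andP[t0 _]; have ? := dy t t0 i; have ? := dy' t t0 i; exact: is_deriveB.
- by move=> t _; exact: (is_deriveZ K (is_derive_expRM a t)).
- move=> t /andP[/ltW t0 _].
  have -> : g t i 0 - g' t i 0 = (g t - g' t) i 0 by rewrite !mxE.
  exact: le_trans (ler_coord _ _) (gK t t0).
by rewrite gerBl /v mulr_ge0 ?expR_ge0.
Qed.

(** In the norm sup_t |x(t)| e^(-2 L t) the Picard operator contracts by 1/2 on
    the whole half-line, so no subdivision into short intervals is needed. *)
Lemma picard_contraction (x x' y y' : R -> 'cV[R]_m) (C : R) : 0 <= C ->
  picard_image x y -> picard_image x' y' ->
  (forall t : R, 0 <= t -> `|x t - x' t| <= C * expR (2 * L * t)) ->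
  forall t : R, 0 <= t -> `|y t - y' t| <= C / 2 * expR (2 * L * t).
Proof.
move=> C0 [cy y0 dy] [cy' y0' dy'] xC.
apply: (@ler_dist_curves _ _ (G \o x) (G \o x')) => //; first by rewrite divr_ge0.
  by rewrite y0 y0'.
move=> t t0; apply: le_trans (GL _ _) _.
apply: le_trans (ler_wpM2l (ltW L0) (xC t t0)) _.
by rewrite le_eqVlt; apply/orP; left; apply/eqP; field.
Qed.

(** The iterates converge pointwise, with distance to the limit bounded by
    2 C 2^-k e^(2 L t); this is locally uniform, so the limit is continuous and
    agrees for t >= 0 with its own Picard image. *)
Lemma picard : exists x : R -> 'cV[R]_m, [/\ continuous x, x 0 = x0 &
  forall t : R, 0 < t -> forall i, is_derive t 1 (fun s => x s i 0) (G (x t) i 0)].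
Proof.
have [Phi PhiE] : exists Phi : (R -> 'cV[R]_m) -> R -> 'cV[R]_m,
    forall x, continuous x -> picard_image x (Phi x).
  have : forall x, exists y, continuous x -> picard_image x y.
    move=> x; have [/picard_step[y xy]|nx] := pselect (continuous x); first by exists y.
    by exists x => /nx.
  by move=> /choice[Phi PhiE]; exists Phi.
pose X k := iter k Phi (fun=> x0).
have cX k : continuous (X k).
  by elim: k => [|k /PhiE[]//]; exact: cst_continuous.
have XE k : picard_image (X k) (X k.+1) by exact: PhiE.
have x0curve : exists2 C, 0 <= C & forall t : R, 0 <= t ->
    `|X 1 t - X 0 t| <= C * expR (2 * L * t).
  have [c1 X10 d1] := XE 0%N.
  exists (`|G x0| / (2 * L)); first by rewrite divr_ge0// mulr_ge0// ltW.
  apply: (@ler_dist_curves _ _ (fun=> G x0) (fun=> 0)) => //.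
  - by rewrite divr_ge0// mulr_ge0// ltW.
  - move=> t t0 i; rewrite mxE; exact: is_derive_cst.
  move=> t t0; rewrite subr0 mulrA divfK ?gt_eqF ?mulr_gt0//.
  by rewrite ler_peMr// -expR0 ler_expR !mulr_ge0// ltW.
have [C C0 X1] := x0curve.
have XS k (t : R) : 0 <= t -> `|X k.+1 t - X k t| <= C / 2 ^+ k * expR (2 * L * t).
  elim: k t => [|k IH] t t0; first by rewrite expr0 divr1 X1.
  apply: le_trans (picard_contraction _ (XE k.+1) (XE k) IH t0) _.
    by rewrite divr_ge0// exprn_ge0.
  by rewrite exprSr invfM mulrA.
have XD k p (t : R) : 0 <= t ->
    `|X (k + p)%N t - X k t| <= (2 * C / 2 ^+ k) * expR (2 * L * t).
  move=> t0.
  suff : `|X (k + p)%N t - X k t| <=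
      (2 * C / 2 ^+ k - 2 * C / 2 ^+ (k + p)) * expR (2 * L * t).
    move=> /le_trans; apply; rewrite ler_wpM2r ?expR_ge0//.
    by rewrite gerBl divr_ge0 ?exprn_ge0// mulr_ge0.
  elim: p => [|p IH]; first by rewrite addn0 !subrr normr0 mul0r.
  rewrite addnS -(subrK (X (k + p)%N t) (X (k + p).+1 t)) -addrA.
  apply: le_trans (ler_normD _ _) _; apply: le_trans (lerD (XS _ _ t0) IH) _.
  rewrite -mulrDl ler_wpM2r ?expR_ge0// exprS invfM.
  by rewrite le_eqVlt; apply/orP; left; apply/eqP; field; rewrite !expf_neq0.
have Xcvg (t : R) : 0 <= t -> cvgn (fun k => X k t).
  move=> t0; apply/cauchy_cvgP/cauchy_exP => e e0.
  have K0 : 0 <= 2 * C * expR (2 * L * t) by rewrite !mulr_ge0 ?expR_ge0.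
  have [k ke] := exists_geometric_lt K0 e0.
  exists (X k t), k => // j /= kj; rewrite -ball_normE/= distrC -(subnKC kj).
  by apply: le_lt_trans (XD _ _ _ t0) _; rewrite mulrAC.
(* The estimates hold for t >= 0 only, hence the truncation of negative times. *)
pose x (t : R) := limn (fun k => X k (Num.max t 0)).
have xX k (t : R) : 0 <= t -> `|x t - X k t| <= (2 * C / 2 ^+ k) * expR (2 * L * t).
  move=> t0; rewrite /x max_l//.
  have h : (fun j => `|X j t - X k t|) @ \oo --> `|limn (X ^~ t) - X k t|.
    by apply: cvg_norm; apply: cvgB; [exact: Xcvg|exact: cvg_cst].
  by apply: (cvgr_to_le h); exists k => // j /= kj; rewrite -(subnKC kj) XD.
have cx : continuous x.
  move=> t; apply/cvgrPdist_lt => e e0.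
  have K0 : 0 <= 2 * C * expR (2 * L * (Num.max t 0 + 1)).
    by rewrite !mulr_ge0 ?expR_ge0.
  have e3 : 0 < e / 3 by rewrite divr_gt0.
  have [k ke] := exists_geometric_lt K0 e3.
  have small (s : R) : 0 <= s <= Num.max t 0 + 1 -> `|x s - X k s| < e / 3.
    move=> /andP[s0 st]; apply: le_lt_trans (xX k s s0) _; apply: le_lt_trans ke.
    rewrite mulrAC ler_wpM2r ?invr_ge0 ?exprn_ge0// ler_wpM2l ?mulr_ge0//.
    by rewrite ler_expR ler_wpM2l// mulr_ge0// ltW.
  have xm (s : R) : x s = x (Num.max s 0) by rewrite /x -maxA maxxx.
  have cXm : continuous (fun s : R => X k (Num.max s 0)).
    move=> s; apply: (@continuous_comp _ _ _ (fun t : R => Num.max t 0) (X k)).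
      exact: continuous_max0.
    exact: cX.
  have tt1 : t < t + 1 by rewrite ltrDl.
  near=> s.
  rewrite (xm t) (xm s).
  have sa : `|x (Num.max t 0) - X k (Num.max t 0)| < e / 3.
    by apply: small; rewrite le_max lexx orbT/= lerDl.
  have sb : `|x (Num.max s 0) - X k (Num.max s 0)| < e / 3.
    apply: small; rewrite le_max lexx orbT/= ge_max; apply/andP; split.
      rewrite (@le_trans _ _ (t + 1))//; last by rewrite lerD2r le_max lexx.
      by near: s; apply: filterS (lt_nbhsl tt1) => s /ltW.
    by rewrite addr_ge0// le_max lexx orbT.
  have sc : `|X k (Num.max t 0) - X k (Num.max s 0)| < e / 3.
    by near: s; move/cvgrPdist_lt : (cXm t); exact.
  rewrite (_ : _ - _ = (x (Num.max t 0) - X k (Num.max t 0)) +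
    (X k (Num.max t 0) - X k (Num.max s 0)) - (x (Num.max s 0) - X k (Num.max s 0)));
    last by rewrite addrA subrK opprB addrA subrK.
  apply: le_lt_trans (ler_normB _ _) _.
  rewrite [e in _ < e](_ : e = e / 3 + e / 3 + e / 3); last by field.
  rewrite ltrD//; apply: le_lt_trans (ler_normD _ _) _; exact: ltrD.
have [cy y0 dy] := PhiE x cx.
have yx (t : R) : 0 <= t -> Phi x t = x t.
  move=> t0; apply/eqP; rewrite -subr_eq0 -normr_le0; apply/ler_addgt0Pl => e e0.
  have K0 : 0 <= 3 * C * expR (2 * L * t) by rewrite !mulr_ge0 ?expR_ge0.
  have [k ke] := exists_geometric_lt K0 e0; rewrite addr0.
  rewrite -(subrK (X k.+1 t) (Phi x t)) -addrA.
  apply: le_trans (ler_normD _ _) _; rewrite (distrC (X _ _)).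
  have Ck : 0 <= 2 * C / 2 ^+ k by rewrite divr_ge0 ?exprn_ge0// mulr_ge0.
  apply: le_trans (lerD (picard_contraction Ck (PhiE x cx) (XE k) (xX k) t0) (xX _ _ t0)) _.
  apply: le_trans (ltW ke); rewrite -mulrDl [leRHS]mulrAC ler_wpM2r ?expR_ge0//.
  rewrite exprS invfM.
  by rewrite -subr_ge0 [X in 0 <= X](_ : _ = C / 2 ^+ k);
    [rewrite divr_ge0 ?exprn_ge0|field; rewrite expf_neq0].
exists (Phi x); split => // t t0 i.
by rewrite yx ?(ltW t0)//; exact: dy.
Unshelve. all: by end_near. Qed.
End Picard.

(** * Projection onto a cube *)

Section Clamp.
Context {R : realType} {m : nat}.
Definition clamp (a : 'cV[R]_m) (rho : R) (x : 'cV[R]_m) : 'cV[R]_m :=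
  \col_i Num.max (a i 0 - rho) (Num.min (a i 0 + rho) (x i 0)).

Lemma clamp_box a rho x : 0 <= rho -> `|clamp a rho x - a| <= rho.
Proof.
move=> rho0; apply: ler_norm_coord => // i; rewrite !mxE ler_distl le_max lexx/=.
by rewrite ge_max ge_min lexx andbT; lra.
Qed.

Lemma clamp_id a rho x : `|x - a| <= rho -> clamp a rho x = x.
Proof.
move=> xa; apply/colP => i; rewrite mxE.
have := le_trans (ler_coord _ i) xa; rewrite !mxE ler_distl => /andP[h1 h2].
by rewrite min_r// max_r.
Qed.

Lemma clamp_lipschitz a rho x y : `|clamp a rho x - clamp a rho y| <= `|x - y|.
Proof.
apply: ler_norm_coord => // i; apply: le_trans (ler_coord _ i); rewrite !mxE.
set u := x i 0; set v := y i 0; move: (a i 0 - rho) (a i 0 + rho) => p q.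
rewrite /Num.max /Num.min; do !case: ifPn; rewrite -?leNgt => *;
  rewrite ?subrr ?normr0//; case: (ler0P (u - v)) => *;
  by rewrite ler_norml; apply/andP; split; lra.
Qed.
End Clamp.

(** * Strict differentiability *)

Section StrictDifferentiability.
Context {R : realType}.

(** Strict differentiability: the increment between any two points near x is
    controlled, not only those from x. It makes F Lipschitz and the constraint
    solvable without any further use of derivatives. *)
Definition strictly_differentiable {p q : nat} (f : 'cV[R]_p -> 'cV[R]_q) (A : 'M[R]_(q, p)) x :=
  forall eps, 0 < eps -> exists2 r, 0 < r & forall y z,
    `|y - x| <= r -> `|z - x| <= r -> `|f y - f z - A *m (y - z)| <= eps * `|y - z|.

Definition scalar_strictly_differentiable (f : R -> R) (a x : R) :=
  forall eps, 0 < eps -> exists2 r, 0 < r & forall y z,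
    `|y - x| <= r -> `|z - x| <= r -> `|f y - f z - a * (y - z)| <= eps * `|y - z|.

(** Mean value theorem on the segment between the two points. *)
Lemma C1_strictly_differentiable (f : R -> R) (x : R) :
  (\forall t \near x, derivable f t 1) -> {for x, continuous (derive1 f)} ->
  scalar_strictly_differentiable f (derive1 f x) x.
Proof.
move=> df cf eps eps0.
have : \forall t \near x, derivable f t 1 /\ `|derive1 f x - derive1 f t| <= eps.
  near=> t; split; first by near: t.
  by near: t; move/cvgrPdist_le: cf; exact.
move=> /nbhs_ballP[d /= d0 dP]; exists (d / 2); first by rewrite divr_gt0.
have inb y : `|y - x| <= d / 2 -> ball x d y.
  move=> yx; rewrite -ball_normE /= distrC; apply: le_lt_trans yx _.
  by rewrite ltr_pdivrMr// ltr_pMr// ltr1n.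
move=> y z.
wlog zy : y z / z <= y.
  move=> wl yx zx; have /orP[zy|yz] := le_total z y; first exact: wl.
  rewrite -normrN (distrC y z).
  rewrite [X in `|X| <= _](_ : _ = f z - f y - derive1 f x * (z - y)); last by ring.
  exact: wl.
move=> yx zx.
have btw t : z <= t <= y -> ball x d t.
  move=> /andP[zt ty]; apply: inb; move: yx zx; rewrite !ler_distl => /andP[? ?] /andP[? ?].
  by apply/andP; split; lra.
have [||c cP ->] := @MVT_segment R f (derive1 f) z y zy.
- move=> t; rewrite in_itv/= => /andP[/ltW zt /ltW ty].
  by split; [have [] := dP t (btw t _); rewrite ?zt|rewrite derive1E].
- apply: derivable_within_continuous => t; rewrite in_itv/= => tP.
  by have [] := dP t (btw t tP).
rewrite in_itv/= in cP.
rewrite -mulrBl normrM ler_wpM2r// distrC.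
by have [] := dP c (btw c cP).
Unshelve. all: by end_near. Qed.

(** The closed-loop injection of an inverter: the remainder is exactly
    k ((y - x) + (z - x)) (y - z). *)
Lemma quadratic_strictly_differentiable (k c x : R) :
  scalar_strictly_differentiable (fun y => y * k * (y - c)) (x * k + k * (x - c)) x.
Proof.
move=> eps eps0; have k0 : 0 < 2 * (`|k| + 1) by rewrite mulr_gt0// ltr_wpDl.
exists (eps / (2 * (`|k| + 1))); first by rewrite divr_gt0.
move=> y z; set r := eps / _ => yx zx.
rewrite [X in `|X| <= _](_ : _ = (k * ((y - x) + (z - x))) * (y - z)); last by ring.
rewrite normrM ler_wpM2r// normrM.
apply: (@le_trans _ _ ((`|k| + 1) * (r + r))).
  by rewrite ler_pM ?lerDl//; apply: le_trans (ler_normD _ _) _; rewrite lerD.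
rewrite le_eqVlt; apply/orP; left; apply/eqP; rewrite /r; field.
by rewrite gt_eqF// ltr_wpDl.
Qed.

Lemma common_lower_bound {N} (r : 'I_N -> R) : (forall i, 0 < r i) ->
  exists2 r0, 0 < r0 & forall i, r0 <= r i.
Proof.
move=> r0; have s0 : 0 < 1 + \sum_i (r i)^-1.
  by rewrite ltr_wpDr// sumr_ge0// => i _; rewrite invr_ge0 ltW.
exists (1 + \sum_i (r i)^-1)^-1; first by rewrite invr_gt0.
move=> i; rewrite -[leRHS]invrK lef_pV2 ?posrE ?invr_gt0// (bigD1 i)//= addrCA lerDl.
by rewrite addr_ge0// sumr_ge0// => j _; rewrite invr_ge0 ltW.
Qed.

(** A power flow balance is a local injection f_i(E_i) plus the bilinear term
    E_i (B E)_i; the i-th remainder of the latter is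
    (y - x)_i (B (y - z))_i + (y - z)_i (B (z - x))_i. *)
Lemma power_flow_strictly_differentiable {N} (f : 'I_N -> R -> R) (a x : 'cV[R]_N)
    (B : 'M[R]_N) :
  (forall i, scalar_strictly_differentiable (f i) (a i 0) (x i 0)) ->
  strictly_differentiable (fun E : 'cV[R]_N => \col_i f i (E i 0) + dgm E *m B *m E)
    (dgm (a + B *m x) + dgm x *m B) x.
Proof.
move=> fa eps eps0.
have [C C0 CP] := mulmx_norm_bound B.
have /choice[rr rrP] : forall i, exists r, 0 < r /\ forall y z,
    `|y - x i 0| <= r -> `|z - x i 0| <= r ->
    `|f i y - f i z - a i 0 * (y - z)| <= eps / 2 * `|y - z|.
  move=> i; have e2 : 0 < eps / 2 by rewrite divr_gt0.
  by have [r r0 rP] := fa i _ e2; exists r.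
have [r1 r1_gt0 r1P] := common_lower_bound (fun i => (rrP i).1).
have r2_gt0 : 0 < eps / (4 * C) by rewrite divr_gt0// mulr_gt0.
exists (Num.min r1 (eps / (4 * C))); first by rewrite lt_min r1_gt0.
move=> y z; rewrite !le_min => /andP[y1 y2] /andP[z1 z2].
apply: ler_norm_coord => [|i]; first by rewrite mulr_ge0// ltW.
set rho := f i (y i 0) - f i (z i 0) - a i 0 * (y i 0 - z i 0).
have -> : (\col_i f i (y i 0) + dgm y *m B *m y - (\col_i f i (z i 0) + dgm z *m B *m z)
    - (dgm (a + B *m x) + dgm x *m B) *m (y - z)) i 0 =
    rho + (y - x) i 0 * (B *m (y - z)) i 0 + (y - z) i 0 * (B *m (z - x)) i 0.
  have Ei (v w : 'cV[R]_N) : (dgm v *m B *m w) i 0 = v i 0 * (B *m w) i 0.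
    by rewrite -mulmxA dgm_mulE.
  have Bsub (v w : 'cV[R]_N) : (B *m (v - w)) i 0 = (B *m v) i 0 - (B *m w) i 0.
    by rewrite mulmxBr !mxE.
  have split4 (u v w t : 'cV[R]_N) : (u + v - (w + t)) i 0 = u i 0 + v i 0 - (w i 0 + t i 0).
    by rewrite !mxE.
  rewrite mulmxDl [LHS]mxE split4.
  rewrite (_ : (- _ : 'cV[R]_N) i 0 = - ((dgm (a + B *m x) *m (y - z)) i 0 +
    (dgm x *m B *m (y - z)) i 0)); last by rewrite !mxE.
  rewrite !Ei dgm_mulE !Bsub !mxE /rho.
  set By := \sum_j _; set Bz := \sum_j _; set Bx := \sum_j _.
  ring.
have rhoP : `|rho| <= eps / 2 * `|y - z|.
  apply: le_trans ((rrP i).2 _ _ _ _) _.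
  - by apply: le_trans (r1P i); apply: le_trans y1; have := ler_coord (y - x) i; rewrite !mxE.
  - by apply: le_trans (r1P i); apply: le_trans z1; have := ler_coord (z - x) i; rewrite !mxE.
  rewrite ler_wpM2l ?divr_ge0 ?(ltW eps0)//.
  by have := ler_coord (y - z) i; rewrite !mxE.
have t1 : `|(y - x) i 0 * (B *m (y - z)) i 0| <= eps / 4 * `|y - z|.
  rewrite normrM; apply: (@le_trans _ _ ((eps / (4 * C)) * (C * `|y - z|))).
    rewrite ler_pM//; first exact: le_trans (ler_coord _ _) y2.
    exact: le_trans (ler_coord _ _) (CP _).
  by rewrite le_eqVlt; apply/orP; left; apply/eqP; field; rewrite gt_eqF.
have t2 : `|(y - z) i 0 * (B *m (z - x)) i 0| <= eps / 4 * `|y - z|.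
  rewrite normrM; apply: (@le_trans _ _ (`|y - z| * (C * (eps / (4 * C))))).
    rewrite ler_pM//; first exact: ler_coord.
    apply: le_trans (ler_coord _ _) _; apply: le_trans (CP _) _.
    by rewrite ler_wpM2l// ltW.
  by rewrite le_eqVlt; apply/orP; left; apply/eqP; field; rewrite gt_eqF.
apply: le_trans (ler_normD _ _) _; apply: le_trans (lerD (ler_normD _ _) t2) _.
by move: rhoP t1; lra.
Qed.

End StrictDifferentiability.

(** * Stability of a differential-algebraic system by linearization *)

(** Joins the complete and the normed structures of matrices, as the contraction
    principle requires. *)
HB.instance Definition _ (R : realType) (p q : nat) :=
  Uniform_isComplete.Build 'M[R]_(p, q) (@mx_complete R p q).

(** Throughout, usubmx selects the algebraic components (loads) and dsubmx the
    differential ones (inverters). *)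
Section Stability.
Context {R : realType} {n m : nat}.
Variables (F : 'cV[R]_(n + m) -> 'cV[R]_(n + m)) (Ebar P : 'cV[R]_(n + m)).
Variables (M : 'M[R]_(n + m)) (tau : 'cV[R]_m).

Let J := dgm P *m M.

Hypotheses (P_gt0 : pos_vec P) (M_neg : negdef M) (tau_gt0 : pos_vec tau).
Hypotheses (F0 : F Ebar = 0) (FJ : strictly_differentiable F J Ebar).

Lemma near_lipschitz : exists r K, [/\ 0 < r, 0 < K & forall y z,
  `|y - Ebar| <= r -> `|z - Ebar| <= r -> `|F y - F z| <= K * `|y - z|].
Proof.
have [C C0 CP] := mulmx_norm_bound J.
have [r r0 rP] := FJ ltr01.
exists r, (1 + C); split => //; first by rewrite addr_gt0.
move=> y z yr zr; rewrite -(subrK (J *m (y - z)) (F y - F z)).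
apply: le_trans (ler_normD _ _) _; rewrite mulrDl lerD//.
exact: rP.
Qed.

Let A := ulsubmx J.

Lemma ulsubmx_J_unit : A \in unitmx.
Proof.
have -> : A = dgm (usubmx P) *m ulsubmx M.
  by apply/matrixP => i j; rewrite /A /J /dgm !mul_diag_mx !mxE.
rewrite unitmx_mul; apply/andP; split.
  have up : pos_vec (usubmx P) by move=> i; rewrite mxE.
  by have /mulmx1_unit[] := dgmK up.
apply: negdef_unit => y y0.
have : col_mx y (0 : 'cV_m) != 0.
  by apply: contra y0; rewrite col_mx_eq0 => /andP[].
move=> /M_neg; rewrite -{1}(submxK M) mul_block_col dot_col_mx dot0l addr0.
by rewrite mulmx0 addr0.
Qed.

Lemma usubmx_mulJ (e : 'cV[R]_(n + m)) :
  usubmx (J *m e) = A *m usubmx e + ursubmx J *m dsubmx e.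
Proof. by rewrite -{1}(submxK J) -{1}(vsubmxK e) mul_block_col col_mxKu. Qed.

(** On the constraint F_L = 0 the linear part satisfies
    A dy + J_LI dx = small (|dx| + |dy|), and A is invertible. This one estimate
    yields uniqueness of the algebraic variables (dx = 0), their Lipschitz
    dependence on the differential ones, and control of the distance to the
    equilibrium (z = Ebar). *)
Lemma constraint_lipschitz : exists r K, [/\ 0 < r, 0 < K & forall y z,
  `|y - Ebar| <= r -> `|z - Ebar| <= r -> usubmx (F y) = 0 -> usubmx (F z) = 0 ->
  `|usubmx y - usubmx z| <= K * `|dsubmx y - dsubmx z|].
Proof.
have [C C0 CP] := mulmx_norm_bound (invmx A).
have [D D0 DP] := mulmx_norm_bound (ursubmx J).
(* With this tolerance the term in |dy| on the right comes with factor 1/2 and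
   is absorbed on the left. *)
have e0 : 0 < (2 * C)^-1 by rewrite invr_gt0 mulr_gt0.
have [r r0 rP] := FJ e0.
exists r, (2 * C * D + 1); split => //.
  by rewrite addr_gt0// !mulr_gt0.
move=> y z yr zr Fy Fz.
set rho := usubmx (F y - F z - J *m (y - z)).
have du : usubmx y - usubmx z =
    - (invmx A *m (ursubmx J *m (dsubmx y - dsubmx z) + rho)).
  have -> : rho = - (A *m usubmx (y - z) + ursubmx J *m dsubmx (y - z)).
    rewrite -usubmx_mulJ /rho linearB/= [usubmx (F y - F z)]linearB/= Fy Fz.
    by rewrite subr0 sub0r.
  rewrite -[dsubmx y - dsubmx z]linearB/= -[usubmx y - usubmx z]linearB/=.
  by rewrite opprD addrCA subrr addr0 mulmxN mulKmx ?ulsubmx_J_unit// opprK.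
have rhoP : `|rho| <= (2 * C)^-1 * `|y - z| by apply: le_trans (ler_usubmx _) (rP _ _ yr zr).
have := ler_norm_sub_mx (y - z); rewrite !linearB/= => yz.
have h : `|usubmx y - usubmx z| <=
    C * (D * `|dsubmx y - dsubmx z| +
      (2 * C)^-1 * (`|usubmx y - usubmx z| + `|dsubmx y - dsubmx z|)).
  rewrite {1}du normrN; apply: le_trans (CP _) _; rewrite ler_wpM2l ?(ltW C0)//.
  apply: le_trans (ler_normD _ _) _; rewrite lerD//.
  by apply: le_trans rhoP _; rewrite ler_wpM2l// ltW.
move: h; set a := `|usubmx y - _|; set b := `|dsubmx y - _| => h.
have : C * (D * b + (2 * C)^-1 * (a + b)) = C * D * b + (a + b) / 2 by field; rewrite gt_eqF.
move=> E; rewrite E in h; rewrite mulrDl mul1r -!mulrA.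
by rewrite -mulrA in h; lra.
Qed.

(** Simplified Newton iteration y - A^-1 F_L(y, x), with the derivative frozen at
    the equilibrium, is a 1/2-contraction of the ball of radius r. *)
Lemma constraint_solvable : exists2 r0, 0 < r0 & forall r, 0 < r <= r0 ->
  exists2 rho, 0 < rho <= r & forall x, `|x - dsubmx Ebar| <= rho ->
  exists2 y, `|y - usubmx Ebar| <= r & usubmx (F (col_mx y x)) = 0.
Proof.
have [C C0 CP] := mulmx_norm_bound (invmx A).
have [r1 [K [r1_gt0 K0 KP]]] := near_lipschitz.
have e0 : 0 < (2 * C)^-1 by rewrite invr_gt0 mulr_gt0.
have [r2 r2_gt0 rP] := FJ e0.
exists (Num.min r1 r2); first by rewrite lt_min r1_gt0.
move=> r /andP[r_gt0]; rewrite le_min => /andP[rr1 rr2].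
have CK0 : 0 < 2 * C * K by rewrite !mulr_gt0.
pose rho := Num.min r (r / (2 * C * K)).
exists rho; first by rewrite lt_min r_gt0 divr_gt0//= ge_min lexx.
move=> x xrho.
have xr : `|x - dsubmx Ebar| <= r by apply: le_trans xrho _; rewrite ge_min lexx.
pose T y := y - invmx A *m usubmx (F (col_mx y x)).
pose U := [set y : 'cV[R]_n | `|y - usubmx Ebar| <= r].
have box y : U y -> `|col_mx y x - Ebar| <= r.
  by move=> Uy; rewrite -(vsubmxK Ebar) opp_col_mx add_col_mx ler_col_mx.
have Tlip y y' : U y -> U y' -> `|T y - T y'| <= 2^-1 * `|y - y'|.
  move=> Uy Uy'.
  have -> : T y - T y' = - (invmx A *m usubmx (F (col_mx y x) - F (col_mx y' x)
      - J *m (col_mx y x - col_mx y' x))).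
    rewrite [usubmx (_ - J *m _)]linearB/= [usubmx (F _ - _)]linearB/= usubmx_mulJ.
    rewrite opp_col_mx add_col_mx subrr col_mxKu col_mxKd mulmx0 addr0.
    rewrite [invmx A *m (_ - A *m _)]mulmxBr mulKmx ?ulsubmx_J_unit// mulmxBr /T.
    set u := invmx A *m _; set v := invmx A *m _.
    by apply/colP => i; rewrite !mxE; ring.
  rewrite normrN; apply: le_trans (CP _) _.
  apply: le_trans (ler_wpM2l (ltW C0) (ler_usubmx _)) _.
  apply: le_trans (ler_wpM2l (ltW C0) (rP _ _ _ _)) _.
  - exact: le_trans (box _ Uy) rr2.
  - exact: le_trans (box _ Uy') rr2.
  rewrite opp_col_mx add_col_mx subrr mulrA invfM mulrCA mulfV ?gt_eqF// mulr1.
  by rewrite ler_wpM2l// ler_col_mx// normr0.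
have Ubar : U (usubmx Ebar) by rewrite /U/= subrr normr0 ltW.
have Tbar : `|T (usubmx Ebar) - usubmx Ebar| <= r / 2.
  rewrite /T addrAC subrr sub0r normrN.
  have -> : usubmx (F (col_mx (usubmx Ebar) x)) =
      usubmx (F (col_mx (usubmx Ebar) x) - F Ebar) by rewrite F0 subr0.
  apply: le_trans (CP _) _.
  apply: le_trans (ler_wpM2l (ltW C0) (ler_usubmx _)) _.
  apply: le_trans (ler_wpM2l (ltW C0) (KP _ _ _ _)) _.
  - exact: le_trans (box _ Ubar) rr1.
  - by rewrite subrr normr0 ltW.
  have -> : `|col_mx (usubmx Ebar) x - Ebar| = `|x - dsubmx Ebar|.
    rewrite -{2}(vsubmxK Ebar) opp_col_mx add_col_mx subrr; apply/eqP.
    rewrite eq_le ler_col_mx ?normr0//=.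
    by rewrite -{1}(col_mxKd (0 : 'cV_n) (x - _)) ler_dsubmx.
  rewrite mulrA -ler_pdivlMl ?mulr_gt0//; apply: le_trans xrho _.
  rewrite ge_min; apply/orP; right; rewrite le_eqVlt; apply/orP; left.
  by apply/eqP; field; rewrite !gt_eqF.
have TU : {homo T : y / U y >-> U y}.
  move=> y Uy; rewrite /U/= -(subrK (T (usubmx Ebar)) (T y)) -addrA.
  apply: le_trans (ler_normD _ _) _; rewrite (splitr r) lerD//.
  by apply: le_trans (Tlip _ _ Uy Ubar) _; rewrite mulrC ler_wpM2r.
have [|||y Uy yT] := @banach_fixed_point R 'cV[R]_n U (mkfun_fun TU).
- exists (2^-1)%:nng; split; first by rewrite /= invf_lt1// ltr1n.
  by move=> -[y y'] [/= Uy Uy']; exact: Tlip.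
- have -> : U = closed_ball (usubmx Ebar) r.
    by rewrite closed_ballE//; apply/seteqP; split => y; rewrite /U/closed_ball_/= distrC.
  exact: closed_ball_closed.
- by exists (usubmx Ebar).
exists y => //.
have /eqP : y - T y = 0 by rewrite [X in X - _]yT subrr.
rewrite /T subKr => /eqP Ay.
by rewrite -[LHS](mulKVmx ulsubmx_J_unit) Ay mulmx0.
Qed.

(** On the constraint the load part of F vanishes, so the form may be taken over
    all components: it equals e . [P]^-1 F = e . M e + o(|e|^2), and the
    coercivity of M absorbs the remainder. *)
Lemma lyapunov_estimate : exists r mu, [/\ 0 < r, 0 < mu & forall E,
  `|E - Ebar| <= r -> usubmx (F E) = 0 ->
  dot (dsubmx (E - Ebar)) (dgm (\col_i (dsubmx P i 0)^-1) *m dsubmx (F E)) <=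
  - mu * dot (dsubmx (E - Ebar)) (dsubmx (E - Ebar))].
Proof.
have [mu mu0 muP] := negdef_coercive M_neg.
pose Pi := dgm (\col_i (P i 0)^-1).
have PiJ : Pi *m J = M by rewrite mulmxA (mulmx1C (dgmK P_gt0)) mul1mx.
have [C C0 CP] := mulmx_norm_bound Pi.
pose N : R := (n + m).+1%:R.
have N0 : 0 < N by rewrite ltr0n.
have e0 : 0 < mu / (2 * N * C) by rewrite divr_gt0// !mulr_gt0.
have [r r0 rP] := FJ e0.
exists r, (mu / 2); split => //; first by rewrite divr_gt0.
move=> E Er FE; set e := E - Ebar.
have -> : dot (dsubmx e) (dgm (\col_i (dsubmx P i 0)^-1) *m dsubmx (F E)) =
    dot e (Pi *m F E).
  rewrite -{2}(vsubmxK e) -(vsubmxK (Pi *m F E)) dot_col_mx.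
  have -> : usubmx (Pi *m F E) = 0.
    apply/colP => i; rewrite mxE dgm_mulE; have /colP/(_ i) := FE.
    by rewrite !mxE => ->; rewrite mulr0.
  rewrite dot0r add0r; congr dot; apply/colP => i.
  by rewrite [RHS]mxE !dgm_mulE !mxE.
have -> : dot e (Pi *m F E) = dot e (M *m e) + dot e (Pi *m (F E - F Ebar - J *m e)).
  by rewrite -dotDr F0 subr0 [Pi *m (F E - _)]mulmxBr [Pi *m (J *m e)]mulmxA PiJ addrC subrK.
have rem : `|dot e (Pi *m (F E - F Ebar - J *m e))| <= mu / 2 * dot e e.
  apply: le_trans (ler_dot_norm _ _) _.
  have h : `|Pi *m (F E - F Ebar - J *m e)| <= C * (mu / (2 * N * C) * `|e|).
    apply: le_trans (CP _) _; rewrite ler_wpM2l ?(ltW C0)//.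
    by apply: rP => //; rewrite subrr normr0 ltW.
  apply: (@le_trans _ _ (N * (`|e| * (C * (mu / (2 * N * C) * `|e|))))).
    by rewrite ler_pM// ?mulr_ge0// ?ler_nat// ler_wpM2l.
  rewrite [leLHS](_ : _ = mu / 2 * `|e| ^+ 2); last by field; rewrite !gt_eqF.
  by rewrite ler_wpM2l ?ler_norm_dot// divr_ge0// ltW.
have ee : dot (dsubmx e) (dsubmx e) <= dot e e.
  by rewrite -{3 4}(vsubmxK e) dot_col_mx lerDr dot_ge0.
have := muP e; move: rem; rewrite ler_norml => /andP[_ h1 h2].
apply: (@le_trans _ _ (- (mu / 2) * dot e e)); first by lra.
by rewrite !mulNr lerN2 ler_wpM2l// divr_ge0// ltW.
Qed.

(** The differential equations at time t, solved for the derivatives. *)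
Definition flows_at (E : R -> 'cV[R]_(n + m)) (t : R) := forall i,
  is_derive t 1 (fun s => dsubmx (E s) i 0) ((tau i 0)^-1 * dsubmx (F (E t)) i 0).

(** The weights tau_i/P_i turn the time derivative of the sum of w_i z_i^2 into
    twice the form of lyapunov_estimate; the algebraic components follow z by
    constraint_lipschitz. *)
Lemma exponential_decay : exists r lam c, [/\ 0 < r, 0 < lam, 0 < c &
  forall (E : R -> 'cV[R]_(n + m)) (T : R), 0 <= T ->
  {within `[0, +oo[, continuous E} ->
  (forall t, 0 <= t <= T -> `|E t - Ebar| <= r /\ usubmx (F (E t)) = 0) ->
  (forall t, 0 < t <= T -> flows_at E t) ->
  `|E T - Ebar| <= c * expR (- lam * T) * `|E 0 - Ebar|].
Proof.
have [r1 [mu [r1_gt0 mu0 muP]]] := lyapunov_estimate.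
have [r2 [K [r2_gt0 K0 KP]]] := constraint_lipschitz.
pose w : 'cV[R]_m := \col_i (tau i 0 / dsubmx P i 0).
have w0 : pos_vec w by move=> i; rewrite !mxE divr_gt0.
have [a [b [a0 b0 aP bP bP']]] := dgm_form_bounds w0.
have lam0 : 0 < mu / b by rewrite divr_gt0.
have q0 : 0 < Num.sqrt (b / a) by rewrite sqrtr_gt0 divr_gt0.
exists (Num.min r1 r2), (mu / b), ((K + 1) * Num.sqrt (b / a)); split => //.
- by rewrite lt_min r1_gt0.
- by rewrite mulr_gt0// addr_gt0.
move=> E T T0 cE Ebox dE.
pose z s := dsubmx (E s - Ebar).
pose V s := \sum_i w i 0 * ((dsubmx (E s) i 0 - dsubmx Ebar i 0) *
  (dsubmx (E s) i 0 - dsubmx Ebar i 0)).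
have VE s : V s = dot (z s) (dgm w *m z s).
  rewrite /V /dot; apply: eq_bigr => i _; rewrite dgm_mulE !mxE.
  by rewrite mulrCA.
have Vdec : V T <= V 0 * expR (- (2 * (mu / b)) * T).
  pose dV t := 2 * \sum_i w i 0 * ((dsubmx (E t) i 0 - dsubmx Ebar i 0) *
    ((tau i 0)^-1 * dsubmx (F (E t)) i 0)).
  apply: (@gronwall R V dV) => //.
  - apply: (@within_continuous_weighted_squares _ _ _ (fun i => w i 0) E (fun=> Ebar)).
      by apply: continuous_subspaceW cE; apply: subset_itvl; rewrite bnd_simp.
    by apply: continuous_subspaceT; exact: cst_continuous.
  - move=> t /andP[t0 tT]; apply: is_derive_weighted_squares => i.
    have tT' : 0 < t <= T by rewrite t0 ltW.
    have := is_deriveB (dE t tT' i) (is_derive_cst (dsubmx Ebar i 0) t 1).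
    by rewrite subr0.
  - move=> t /andP[t0 tT].
    have [|] := Ebox t; first by rewrite !ltW.
    rewrite le_min => /andP[Er _] FE.
    have := muP _ Er FE => h.
    have -> : dV t = 2 * dot (z t) (dgm (\col_i (dsubmx P i 0)^-1) *m dsubmx (F (E t))).
      congr (2 * _); apply: eq_bigr => i _; rewrite dgm_mulE !mxE.
      have tn0 : tau i 0 != 0 by rewrite gt_eqF.
      have Pn0 : P (rshift n i) 0 != 0 by rewrite gt_eqF.
      by field; rewrite tn0 Pn0.
    rewrite VE !mulNr -mulrA -mulrN ler_wpM2l//.
    apply: le_trans h _; rewrite mulNr lerN2 -mulrA ler_wpM2l ?(ltW mu0)//.
    by rewrite mulrC ler_pdivrMr// mulrC bP.
have zT : `|z T| <= Num.sqrt (b / a) * expR (- (mu / b) * T) * `|z 0|.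
  rewrite -ler_sqr ?nnegrE ?mulr_ge0 ?expR_ge0 ?sqrtr_ge0//.
  rewrite !exprMn sqr_sqrtr ?divr_ge0 ?(ltW a0) ?(ltW b0)// -expRM_natl.
  rewrite -(ler_pM2l a0); apply: le_trans (aP _) _; rewrite -VE.
  apply: le_trans Vdec _.
  have -> : - (2 * (mu / b)) * T = 2%:R * (- (mu / b) * T) by ring.
  rewrite [X in _ <= X](_ : _ = (b * `|z 0| ^+ 2) * expR (2%:R * (- (mu / b) * T))).
    by rewrite ler_wpM2r ?expR_ge0// VE bP'.
  by field; rewrite gt_eqF.
have [|] := Ebox T; first by rewrite T0 lexx.
rewrite le_min => /andP[_ Er2] FE.
apply: le_trans (ler_norm_sub_mx _) _.
have ET : `|usubmx (E T - Ebar)| <= K * `|z T|.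
  rewrite /z !linearB/=; apply: KP => //; first by rewrite subrr normr0 ltW.
  by rewrite F0 linear0.
apply: (@le_trans _ _ ((K + 1) * `|z T|)); first by rewrite mulrDl mul1r lerD.
rewrite -!mulrA ler_wpM2l ?addr_ge0 ?(ltW K0)//.
apply: le_trans zT _; rewrite mulrA ler_wpM2l ?mulr_ge0 ?expR_ge0 ?sqrtr_ge0//.
exact: ler_dsubmx.
Qed.

(** Curves that solve the system as long as they stay within distance rho of the
    equilibrium. Both genuine solutions and the curve obtained from the truncated
    equation are of this kind, so one confinement argument serves for both. *)
Definition local_solution (rho : R) (E : R -> 'cV[R]_(n + m)) :=
  [/\ {within `[0, +oo[, continuous E},
      forall t, 0 <= t -> `|E t - Ebar| <= rho -> usubmx (F (E t)) = 0
    & forall t, 0 < t -> `|E t - Ebar| <= rho -> flows_at E t].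

Lemma dae_local_solution rho E : dae_solution tau F E -> local_solution rho E.
Proof.
move=> [cE alg diff]; split => // [t t0 _|t t0 _ i]; first exact: alg.
have [dE eqE] := diff t t0.
have /derivable_mxP dEi := dE.
apply: DeriveDef; first exact: dEi.
have := congr1 (fun v => dsubmx v i 0) eqE.
rewrite col_mxKd dgm_mulE derive1E derive_mx// mxE => <-.
by rewrite mulKf// gt_eqF.
Qed.

Lemma local_dae_solution rho E : local_solution rho E ->
  (forall t, 0 <= t -> `|E t - Ebar| <= rho) -> dae_solution tau F E.
Proof.
move=> [cE alg diff] box; split => // [t t0|t t0].
  by apply: alg => //; exact: box.
have /diff h : 0 < t by []; have {}h := h (box _ (ltW t0)).
have dE : derivable (fun s => dsubmx (E s)) t 1.
  by apply/derivable_mxP => i j; rewrite (ord1 j); have [] := h i.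
split => //; rewrite -[RHS]vsubmxK alg ?box ?ltW//; congr col_mx.
apply/colP => i; rewrite dgm_mulE derive1E derive_mx// mxE.
by have [_ ->] := h i; rewrite mulVKf// gt_eqF.
Qed.

(** As long as the curve stays within rho, the decay estimate keeps it within
    c |E 0 - Ebar| < rho. *)
Lemma confinement : exists r lam c, [/\ 0 < r, 0 < lam, 0 < c &
  forall rho E, 0 < rho <= r -> local_solution rho E ->
  `|E 0 - Ebar| < rho / (c + 1) ->
  forall t, 0 <= t -> `|E t - Ebar| <= rho /\
    `|E t - Ebar| <= c * expR (- lam * t) * `|E 0 - Ebar|].
Proof.
have [r [lam [c [r0 lam0 c0 decay]]]] := exponential_decay.
exists r, lam, c; split => // rho E /andP[rho0 rhor] [cE alg diff] E0.
have c1 : 0 < c + 1 by rewrite addr_gt0.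
have decT T : 0 <= T -> (forall t, 0 <= t <= T -> `|E t - Ebar| <= rho) ->
    `|E T - Ebar| <= c * expR (- lam * T) * `|E 0 - Ebar|.
  move=> T0 box; apply: decay => // t tT.
    have tb := box t tT; split; first exact: le_trans rhor.
    by apply: alg => //; case/andP: tT.
  case/andP: tT => t0 tT; apply: diff => //; apply: box; rewrite tT andbT; exact: ltW.
suff box t : 0 <= t -> `|E t - Ebar| <= rho.
  move=> t t0; split; first exact: box.
  by apply: decT => // s /andP[s0 _]; exact: box.
move: t; apply: (@trapping _ (fun t => `|E t - Ebar|)).
- by move=> t; apply: cvg_norm; apply: cvgB; [exact: cE|exact: cvg_cst].
- apply: lt_le_trans E0 _; rewrite ler_pdivrMr// ler_peMr ?(ltW rho0)//.
  by rewrite lerDr ltW.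
move=> T T0 /(decT T T0) h; apply: le_lt_trans h _.
apply: (@le_lt_trans _ _ (c * `|E 0 - Ebar|)).
  rewrite -mulrA ler_wpM2l ?(ltW c0)// ler_piMl//.
  by rewrite -expR0 ler_expR mulNr oppr_le0 mulr_ge0// ltW.
rewrite mulrC -ltr_pdivlMr//; apply: lt_le_trans E0 _.
by rewrite ler_pM2l// lef_pV2 ?posrE// lerDl.
Qed.

(** The algebraic components are a Lipschitz function of the differential ones,
    so the squared distance D of the latter satisfies D' <= a D. *)
Lemma local_solution_unique : exists2 r, 0 < r & forall rho E E',
  0 < rho <= r -> local_solution rho E -> local_solution rho E' ->
  (forall t, 0 <= t -> `|E t - Ebar| <= rho) ->
  (forall t, 0 <= t -> `|E' t - Ebar| <= rho) ->
  E 0 = E' 0 -> forall t, 0 <= t -> E t = E' t.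
Proof.
have [r1 [K1 [r1_gt0 K1_gt0 K1P]]] := near_lipschitz.
have [r2 [K2 [r2_gt0 K2_gt0 K2P]]] := constraint_lipschitz.
exists (Num.min r1 r2); first by rewrite lt_min r1_gt0.
move=> rho E E' /andP[rho0]; rewrite le_min => /andP[rr1 rr2].
move=> [cE alg diff] [cE' alg' diff'] box box' EE' T T0.
have uE t : 0 <= t -> `|usubmx (E t) - usubmx (E' t)| <=
    K2 * `|dsubmx (E t) - dsubmx (E' t)|.
  move=> t0; apply: K2P.
  - exact: le_trans (box _ t0) rr2.
  - exact: le_trans (box' _ t0) rr2.
  - by apply: alg => //; exact: box.
  - by apply: alg' => //; exact: box'.
suff dE : dsubmx (E T) = dsubmx (E' T).
  rewrite -(vsubmxK (E T)) -(vsubmxK (E' T)) dE; congr col_mx.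
  apply/eqP; rewrite -subr_eq0 -normr_le0.
  by apply: le_trans (uE T T0) _; rewrite dE subrr normr0 mulr0.
have [C C0 CP] := mulmx_norm_bound (dgm (\col_i (tau i 0)^-1)).
pose z s := dsubmx (E s) - dsubmx (E' s).
pose D s := \sum_i 1 * ((dsubmx (E s) i 0 - dsubmx (E' s) i 0) *
  (dsubmx (E s) i 0 - dsubmx (E' s) i 0)).
have DE s : D s = dot (z s) (z s).
  by apply: eq_bigr => i _; rewrite !mxE mul1r.
pose dD s := 2 * \sum_i 1 * ((dsubmx (E s) i 0 - dsubmx (E' s) i 0) *
  ((tau i 0)^-1 * dsubmx (F (E s)) i 0 - (tau i 0)^-1 * dsubmx (F (E' s)) i 0)).
pose a := 2 * (m%:R * (C * (K1 * (K2 + 1)))).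
have := @gronwall R D dD a T T0.
have D0 : D 0 = 0 by rewrite DE /z EE' subrr dot0l.
rewrite D0 mul0r DE => gr.
suff h : dot (z T) (z T) <= 0.
  by apply/eqP; rewrite -subr_eq0; apply: contraT => /dot_gt0; rewrite ltNge h.
apply: gr.
- apply: (@within_continuous_weighted_squares _ _ _ (fun=> 1) E E').
    apply: continuous_subspaceW cE; apply: subset_itvl; by rewrite bnd_simp.
  apply: continuous_subspaceW cE'; apply: subset_itvl; by rewrite bnd_simp.
- move=> t /andP[t0 _]; apply: is_derive_weighted_squares => i.
  exact: is_deriveB (diff _ t0 (box _ (ltW t0)) i) (diff' _ t0 (box' _ (ltW t0)) i).
move=> t /andP[t0 _].
have -> : dD t = 2 * dot (z t)
    (dgm (\col_i (tau i 0)^-1) *m dsubmx (F (E t) - F (E' t))).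
  congr (2 * _); apply: eq_bigr => i _; rewrite dgm_mulE !mxE.
  by ring.
rewrite DE /a -mulrA ler_wpM2l//.
apply: le_trans (ler_norm _) _; apply: le_trans (ler_dot_norm _ _) _.
rewrite -mulrA ler_wpM2l//.
apply: le_trans (_ : _ <= (C * (K1 * (K2 + 1))) * `|z t| ^+ 2) _; last first.
  by rewrite ler_wpM2l ?ler_norm_dot// !mulr_ge0 ?addr_ge0// ltW.
rewrite expr2 mulrCA ler_wpM2l//; apply: le_trans (CP _) _.
rewrite -!mulrA ler_wpM2l ?(ltW C0)//; apply: le_trans (ler_dsubmx _) _.
apply: le_trans (K1P _ _ _ _) _.
- exact: le_trans (box _ (ltW t0)) rr1.
- exact: le_trans (box' _ (ltW t0)) rr1.
rewrite ler_wpM2l ?(ltW K1_gt0)//; apply: le_trans (ler_norm_sub_mx _) _.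
by rewrite !linearB/= mulrDl mul1r lerD// uE// ltW.
Qed.

(** Composing the differential equation with the projection onto the cube of
    radius rho makes its right-hand side globally Lipschitz. *)
Lemma local_solution_exists : exists2 r0, 0 < r0 & forall r, 0 < r <= r0 ->
  exists2 rho, 0 < rho <= r & forall E0, usubmx (F E0) = 0 -> `|E0 - Ebar| <= rho ->
  exists2 E, local_solution rho E & E 0 = E0.
Proof.
have [r1 [K1 [r1_gt0 K1_gt0 K1P]]] := near_lipschitz.
have [r2 [K2 [r2_gt0 K2_gt0 K2P]]] := constraint_lipschitz.
have [r3 r3_gt0 solve] := constraint_solvable.
exists (Num.min r1 (Num.min r2 r3)); first by rewrite !lt_min r1_gt0 r2_gt0.
move=> r /andP[r_gt0]; rewrite !le_min => /and3P[rr1 rr2 rr3].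
have [|rho /andP[rho_gt0 rhor] hP] := solve r; first by rewrite r_gt0.
exists rho; first by rewrite rho_gt0.
move=> E0 FE0 E0rho.
pose xbar := dsubmx Ebar.
have [h hE] : exists h, forall x, `|x - xbar| <= rho ->
    `|h x - usubmx Ebar| <= r /\ usubmx (F (col_mx (h x) x)) = 0.
  have : forall x, exists y, `|x - xbar| <= rho ->
      `|y - usubmx Ebar| <= r /\ usubmx (F (col_mx y x)) = 0.
    move=> x; have [/hP[y y1 y2]|nx] := pselect (`|x - xbar| <= rho); first by exists y.
    by exists 0.
  by move=> /choice[h hE]; exists h.
pose cl := clamp xbar rho.
have clb x : `|cl x - xbar| <= rho by apply: clamp_box; exact: ltW.
(* H parametrizes the constraint set near Ebar; it is defined everywhere. *)
pose H x := col_mx (h (cl x)) (cl x).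
have Hbox x : `|H x - Ebar| <= r.
  rewrite -(vsubmxK Ebar) opp_col_mx add_col_mx ler_col_mx//; first by have [] := hE _ (clb x).
  exact: le_trans (clb x) rhor.
have FH x : usubmx (F (H x)) = 0 by have [] := hE _ (clb x).
have Hlip x y : `|H x - H y| <= (K2 + 1) * `|x - y|.
  apply: le_trans (ler_norm_sub_mx _) _; rewrite !linearB/= mulrDl mul1r.
  have clxy : `|dsubmx (H x) - dsubmx (H y)| <= `|x - y|.
    by rewrite !col_mxKd clamp_lipschitz.
  rewrite lerD//; apply: le_trans (K2P _ _ _ _ (FH x) (FH y)) _.
  - exact: le_trans (Hbox x) rr2.
  - exact: le_trans (Hbox y) rr2.
  by rewrite ler_wpM2l// ltW.
have [C C0 CP] := mulmx_norm_bound (dgm (\col_i (tau i 0)^-1)).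
pose G x := dgm (\col_i (tau i 0)^-1) *m dsubmx (F (H x)).
have L0 : 0 < C * (K1 * (K2 + 1)) by rewrite !mulr_gt0// addr_gt0.
have GL x y : `|G x - G y| <= C * (K1 * (K2 + 1)) * `|x - y|.
  rewrite -mulmxBr -linearB/= -!mulrA; apply: le_trans (CP _) _.
  rewrite ler_wpM2l ?(ltW C0)//; apply: le_trans (ler_dsubmx _) _.
  apply: le_trans (K1P _ _ _ _) _.
  - exact: le_trans (Hbox x) rr1.
  - exact: le_trans (Hbox y) rr1.
  by rewrite ler_wpM2l ?(ltW K1_gt0).
have [x [cx x0 dx]] := picard (dsubmx E0) L0 GL.
have K2_1 : 0 < K2 + 1 by rewrite addr_gt0.
(* The differential part is x itself, so that its derivative is the one given by G. *)
pose E t := col_mx (h (cl (x t))) (x t).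
have EH t : `|E t - Ebar| <= rho -> E t = H (x t).
  move=> Et; rewrite /E /H; congr col_mx; rewrite [RHS]clamp_id//.
  by apply: le_trans Et; apply: le_trans (ler_dsubmx _); rewrite linearB/= col_mxKd.
exists E; first split.
- apply: continuous_subspaceT; apply: continuous_colP => i.
  rewrite /E; case: (split_ordP i) => j ->.
    rewrite (_ : (fun t => _) = (fun t => H (x t) (lshift m j) 0)); last first.
      by apply/funext => t; rewrite !col_mxEu.
    move=> t; apply: (@continuous_comp _ _ _ (H \o x) (fun v : 'cV[R]_(n + m) => v (lshift m j) 0)).
      apply: continuous_comp; first exact: cx.
      exact: lipschitz_continuous K2_1 Hlip _.
    exact: coord_continuous.
  rewrite (_ : (fun t => _) = (fun t => x t j 0)); last first.
    by apply/funext => t; rewrite !col_mxEd.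
  move=> t; apply: (@continuous_comp _ _ _ x (fun v : 'cV[R]_m => v j 0)).
    exact: cx.
  exact: coord_continuous.
- by move=> t _ /EH ->.
- move=> t t0 Et i; rewrite (_ : (fun s => _) = (fun s => x s i 0)); last first.
    by apply/funext => s; rewrite col_mxKd.
  by rewrite EH//; have := dx t t0 i; rewrite /G dgm_mulE !mxE.
rewrite /E x0 -[RHS]vsubmxK; congr col_mx.
have dE0 : `|dsubmx E0 - xbar| <= rho.
  by apply: le_trans E0rho; rewrite -linearB ler_dsubmx.
apply/eqP; rewrite -subr_eq0 -normr_le0.
have := K2P (H (dsubmx E0)) E0.
rewrite /H !col_mxKu !col_mxKd /cl (clamp_id dE0) subrr normr0 mulr0; apply.
- by have := Hbox (dsubmx E0); rewrite /H /cl (clamp_id dE0) => /le_trans; apply.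
- exact: le_trans (le_trans E0rho rhor) rr2.
- by have := FH (dsubmx E0); rewrite /H /cl (clamp_id dE0).
- exact: FE0.
Qed.

(** A radius rho valid for the existence, uniqueness and confinement statements,
    and initial distance below rho/(c + 1). *)
Theorem linearized_stability : locally_exponentially_stable tau F Ebar.
Proof.
split=> //.
have [r1 [lam [c [r1_gt0 lam0 c0 conf]]]] := confinement.
have [r2 r2_gt0 uniq] := local_solution_unique.
have [r3 r3_gt0 ex] := local_solution_exists.
pose r := Num.min r1 (Num.min r2 r3).
have r_gt0 : 0 < r by rewrite !lt_min r1_gt0 r2_gt0.
have [rr1 rr2 rr3] : [/\ r <= r1, r <= r2 & r <= r3].
  by rewrite /r !ge_min !lexx !orbT.
have [|rho /andP[rho0 rhor] hex] := ex r; first by rewrite r_gt0.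
have c1 : 0 < c + 1 by rewrite addr_gt0.
exists (rho / (c + 1)), c, lam; split => //; first by rewrite divr_gt0.
move=> E0 FE0 E0d.
have E0rho : `|E0 - Ebar| <= rho.
  apply/ltW/(lt_le_trans E0d); rewrite ler_pdivrMr// ler_peMr ?(ltW rho0)//.
  by rewrite lerDr ltW.
have [E Esol EE0] := hex E0 FE0 E0rho.
have Ed : `|E 0 - Ebar| < rho / (c + 1) by rewrite EE0.
have rho1 : 0 < rho <= r1 by rewrite rho0 (le_trans rhor).
have rho2 : 0 < rho <= r2 by rewrite rho0 (le_trans rhor).
have Econf := conf rho E rho1 Esol Ed.
exists E; split => //.
- by apply: (local_dae_solution Esol) => t /Econf[].
- move=> E' /(dae_local_solution rho) E'sol E'E0 t t0.
  have E'd : `|E' 0 - Ebar| < rho / (c + 1) by rewrite E'E0.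
  have E'conf := conf rho E' rho1 E'sol E'd.
  apply: (uniq rho) => //.
  + by move=> s /E'conf[].
  + by move=> s /Econf[].
  + by rewrite E'E0.
- by move=> t /Econf[_]; rewrite EE0.
Qed.
End Stability.

(** * Schur complements of symmetric matrices *)

Section Schur.
Context {R : realType} {n m : nat} (A : 'M[R]_(n + m)).
Hypotheses (A_sym : A^T = A) (D_unit : drsubmx A \in unitmx).

Definition schur : 'M[R]_n :=
  ulsubmx A - ursubmx A *m invmx (drsubmx A) *m dlsubmx A.

Lemma tr_dlsubmx_sym : (dlsubmx A)^T = ursubmx A.
Proof. by rewrite -{2}A_sym trmx_dlsub. Qed.

Lemma tr_drsubmx_sym : (drsubmx A)^T = drsubmx A.
Proof. by rewrite trmx_drsub A_sym. Qed.

Lemma schur_sym : schur^T = schur.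
Proof.
rewrite /schur linearB/= !trmx_mul trmx_inv tr_dlsubmx_sym tr_drsubmx_sym.
by rewrite -tr_dlsubmx_sym trmxK trmx_ulsub A_sym mulmxA.
Qed.

(** Completing the square in z. *)
Lemma schur_form (y : 'cV[R]_n) (z : 'cV[R]_m) :
  let u := z + invmx (drsubmx A) *m (dlsubmx A *m y) in
  dot (col_mx y z) (A *m col_mx y z) =
  dot y (schur *m y) + dot u (drsubmx A *m u).
Proof.
set D := drsubmx A; set C := dlsubmx A => u.
have Du : D *m u = C *m y + D *m z by rewrite mulmxDr mulKVmx// addrC.
rewrite -{1}(submxK A) mul_block_col dot_col_mx -/C -/D -Du.
have -> : schur *m y = ulsubmx A *m y - ursubmx A *m (invmx D *m (C *m y)).
  by rewrite mulmxBl -!mulmxA.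
rewrite -tr_dlsubmx_sym -/C dotDr dotDr dotNr !(dot_mulmx C^T) trmxK.
rewrite {2}/u dotDl.
have -> : dot (invmx D *m (C *m y)) (D *m u) = dot (C *m y) u.
  by rewrite dot_mulmx tr_drsubmx_sym mulKVmx.
rewrite {2}/u dotDr; ring.
Qed.

(** Evaluate the form of A at the z for which the completed square vanishes. *)
Lemma negdef_schur : negdef A -> negdef schur.
Proof.
move=> nA y y0; pose z := - (invmx (drsubmx A) *m (dlsubmx A *m y)).
have := schur_form y z; rewrite /z addNr dot0l addr0 => <-.
by apply: nA; apply: contra y0; rewrite col_mx_eq0 => /andP[].
Qed.

Lemma negdef_of_schur : negdef schur -> negdef (drsubmx A) -> negdef A.
Proof.
move=> nS nD v; rewrite -(vsubmxK v); set y := usubmx v; set z := dsubmx v.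
rewrite schur_form => v0; set u := z + _.
have leS x : dot x (schur *m x) <= 0.
  by have [->|/nS/ltW//] := eqVneq x 0; rewrite dot0l.
have leD x : dot x (drsubmx A *m x) <= 0.
  by have [->|/nD/ltW//] := eqVneq x 0; rewrite dot0l.
have [y0|/nS y0] := eqVneq y 0; last first.
  by have := ltr_leD y0 (leD u); rewrite addr0.
have uz : u = z by rewrite /u y0 !mulmx0 addr0.
have z0 : z != 0 by move: v0; rewrite col_mx_eq0 y0 eqxx.
by rewrite y0 dot0l add0r uz nD.
Qed.

End Schur.

(** * Susceptance matrices as graph Laplacians *)

Section Susceptance.
Context {R : realType} {N : nat} (e : rel 'I_N) (B : 'M[R]_N).
Hypotheses (hB : susceptance_matrix e B).

Lemma susceptance_sym : B^T = B.
Proof. by have [sym _ _ _] := hB; apply/matrixP => i j; rewrite mxE. Qed.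

Lemma susceptance_offdiag_ge0 i j : i != j -> 0 <= B i j.
Proof.
have [_ pos zero _] := hB => ij.
by have [/pos/ltW//|/zero->] := boolP (e i j).
Qed.

Lemma susceptance_row_sum i : \sum_j B i j = 0.
Proof. by have [_ _ _ diag] := hB; rewrite (bigD1 i)//= diag addNr. Qed.

Lemma laplacian_form x :
  dot x (B *m x) = - (2^-1 * \sum_i \sum_j B i j * (x i 0 - x j 0) ^+ 2).
Proof.
have sq : \sum_i \sum_j B i j * (x i 0 - x j 0) ^+ 2 =
    \sum_i \sum_j B i j * x i 0 ^+ 2 + \sum_i \sum_j B i j * x j 0 ^+ 2
    - 2 * \sum_i \sum_j x i 0 * (B i j * x j 0).
  rewrite mulr_sumr -big_split -sumrB; apply: eq_bigr => i _ /=.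
  rewrite mulr_sumr -big_split -sumrB; apply: eq_bigr => j _ /=.
  by ring.
have z1 : \sum_i \sum_j B i j * x i 0 ^+ 2 = 0.
  by apply: big1 => i _; rewrite -mulr_suml susceptance_row_sum mul0r.
have z2 : \sum_i \sum_j B i j * x j 0 ^+ 2 = 0.
  rewrite exchange_big; apply: big1 => i _ /=.
  transitivity ((\sum_j B i j) * x i 0 ^+ 2); last by rewrite susceptance_row_sum mul0r.
  rewrite mulr_suml.
  by apply: eq_bigr => j _; have [sym _ _ _] := hB; rewrite sym.
have -> : dot x (B *m x) = \sum_i \sum_j x i 0 * (B i j * x j 0).
  by apply: eq_bigr => i _; rewrite mxE mulr_sumr.
by rewrite sq z1 z2; field.
Qed.

Let term_ge0 (x : 'cV[R]_N) i j : 0 <= B i j * (x i 0 - x j 0) ^+ 2.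
Proof.
have [->|ij] := eqVneq i j; first by rewrite subrr expr0n mulr0.
by rewrite mulr_ge0 ?sqr_ge0// susceptance_offdiag_ge0.
Qed.

Lemma laplacian_form_le0 x : dot x (B *m x) <= 0.
Proof.
rewrite laplacian_form oppr_le0 mulr_ge0// sumr_ge0// => i _.
by rewrite sumr_ge0.
Qed.

(** Equality forces x to agree across every edge, hence along paths. *)
Lemma laplacian_form_eq0 x : connected_graph e -> dot x (B *m x) = 0 ->
  forall i j, x i 0 = x j 0.
Proof.
move=> [_ _ conn] /eqP; rewrite laplacian_form oppr_eq0 mulf_eq0 invr_eq0 pnatr_eq0/=.
have ge0 i : 0 <= \sum_j B i j * (x i 0 - x j 0) ^+ 2 by rewrite sumr_ge0.
rewrite psumr_eq0// => /allP h.
have edge i j : e i j -> x i 0 = x j 0.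
  move=> ij; have := h i (mem_index_enum _); rewrite /= psumr_eq0//.
  move=> /allP/(_ j (mem_index_enum _)) /=; rewrite mulf_eq0 expf_eq0/= subr_eq0.
  by have [_ pos _ _] := hB; rewrite gt_eqF ?pos//= => /eqP.
move=> i j; have /connectP[p ep ->] := conn i j.
by elim: p i ep => //= k p IH i /andP[/edge -> /IH].
Qed.

End Susceptance.

(** * Negative definiteness and equilibrium voltages of the network *)

Section Network.
Context {R : realType} {n m : nat} (e : rel 'I_(n + m)) (B : 'M[R]_(n + m)).
Context (k EIs : 'cV[R]_m).
Hypotheses (hm : (0 < m)%N) (he : connected_graph e) (hB : susceptance_matrix e B).
Hypotheses (hk : neg_vec k).

Let NI := drsubmx B + dgm k.

Lemma gain_form_lt0 (z : 'cV[R]_m) : z != 0 -> dot z (dgm k *m z) < 0.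
Proof.
move=> z0; have -> : dgm k = - dgm (- k) by rewrite /dgm !linearN/= opprK.
by rewrite mulNmx dotNr oppr_lt0 dgm_form_gt0// => i; rewrite mxE oppr_gt0.
Qed.

Lemma negdef_inverter_block : negdef NI.
Proof.
move=> z z0; rewrite mulmxDl dotDr.
have := laplacian_form_le0 hB (col_mx 0 z).
rewrite -{1}(submxK B) mul_block_col dot_col_mx dot0l add0r mulmx0 add0r => h.
by have := ler_ltD h (gain_form_lt0 z0); rewrite addr0.
Qed.

Lemma inverter_block_unit : NI \in unitmx.
Proof. exact: negdef_unit negdef_inverter_block. Qed.

(** The closed-loop Jacobian at the equilibrium is [Ebar] times this matrix, for
    q the load_slope below. *)
Definition linearization (q : 'cV[R]_n) : 'M[R]_(n + m) := B + dgm (col_mx q k).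

Lemma linearizationE q : linearization q =
  block_mx (ulsubmx B + dgm q) (ursubmx B) (dlsubmx B) NI.
Proof.
by rewrite /linearization -{1}(submxK B) dgm_col_mx add_block_mx !addr0.
Qed.

Lemma linearization_sym q : (linearization q)^T = linearization q.
Proof. by rewrite /linearization linearD/= (susceptance_sym hB) tr_dgm. Qed.

Lemma schur_linearization q : schur (linearization q) = B_red B k + dgm q.
Proof.
rewrite /schur linearizationE block_mxKul block_mxKur block_mxKdr block_mxKdl.
by rewrite /B_red addrAC.
Qed.

Lemma drsubmx_linearization q : drsubmx (linearization q) = NI.
Proof. by rewrite linearizationE block_mxKdr. Qed.

(** A zero of the Laplacian form is constant on the connected graph, and the
    gains force it to vanish on the inverters, of which there is at least
    one. *)
Lemma negdef_linearization0 : negdef (linearization 0).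
Proof.
move=> v v0; rewrite mulmxDl dotDr.
have -> : dot v (dgm (col_mx 0 k) *m v) = dot (dsubmx v) (dgm k *m dsubmx v).
  rewrite dgm_col_mx -{1 2}(vsubmxK v) mul_block_col dot_col_mx.
  by rewrite !mul0mx add0r addr0 /dgm trmx0 linear0 mul0mx dot0r add0r.
have le0 := laplacian_form_le0 hB v.
have [z0|/gain_form_lt0 z0] := eqVneq (dsubmx v) 0; last first.
  by have := ler_ltD le0 z0; rewrite addr0.
rewrite z0 dot0l addr0 lt_neqAle le0 andbT; apply: contra v0 => /eqP.
move=> /(laplacian_form_eq0 hB he) cst; apply/eqP/colP => i.
rewrite (cst i (rshift n (Ordinal hm))) mxE.
by have /colP/(_ (Ordinal hm)) := z0; rewrite !mxE.
Qed.

(** B_red is the Schur complement of B + diag(0, K_I). *)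
Lemma B_red_unit : B_red B k \in unitmx.
Proof.
have dgm0 : dgm (0 : 'cV[R]_n) = 0 by rewrite /dgm trmx0 linear0.
have <- : schur (linearization 0) = B_red B k by rewrite schur_linearization dgm0 addr0.
apply/negdef_unit/negdef_schur; [exact: linearization_sym|..].
  by rewrite drsubmx_linearization inverter_block_unit.
exact: negdef_linearization0.
Qed.

Lemma B_red_sym : (B_red B k)^T = B_red B k.
Proof.
have dgm0 : dgm (0 : 'cV[R]_n) = 0 by rewrite /dgm trmx0 linear0.
have <- : schur (linearization 0) = B_red B k by rewrite schur_linearization dgm0 addr0.
by apply: schur_sym; exact: linearization_sym.
Qed.

Lemma negdef_linearization q : negdef (B_red B k + dgm q) -> negdef (linearization q).
Proof.
move=> nS; apply: negdef_of_schur.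
- exact: linearization_sym.
- by rewrite drsubmx_linearization inverter_block_unit.
- by rewrite schur_linearization.
- by rewrite drsubmx_linearization; exact: negdef_inverter_block.
Qed.

Variables (EL : 'cV[R]_n) (EI : 'cV[R]_m).
Hypothesis hEI : EI = W2 B k *m col_mx EL EIs.

Lemma inverter_equation : NI *m EI = - (dlsubmx B *m EL) + dgm k *m EIs.
Proof.
by rewrite hEI /W2 -mulmxA mulKVmx ?inverter_block_unit// mul_row_col mulNmx.
Qed.

Lemma inverter_equilibrium :
  dgm k *m (EI - EIs) + dsubmx (B *m col_mx EL EI) = 0.
Proof.
rewrite -{1}(submxK B) mul_block_col col_mxKd mulmxBr.
have := inverter_equation; rewrite mulmxDl.
move: (dgm k *m EI) (dgm k *m EIs) (dlsubmx B *m EL) (drsubmx B *m EI) => a b c d.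
by move=> /colP h; apply/colP => i; have := h i; rewrite !mxE; lra.
Qed.

(** Eliminating EI turns the network currents at the loads into those of the
    reduced network; EL_star absorbs the contribution of the set points, which
    uses the invertibility of B_red. *)
Lemma load_currents : B_red B k *m (EL - EL_star B k EIs) = usubmx (B *m col_mx EL EI).
Proof.
rewrite -[in RHS](submxK B) mul_block_col col_mxKu mulmxBr /EL_star /W1.
rewrite !mulNmx mulmxN opprK -!mulmxA (mulKVmx B_red_unit).
have -> : EI = invmx NI *m (dgm k *m EIs) - invmx NI *m (dlsubmx B *m EL).
  by rewrite -mulmxBr addrC -inverter_equation mulKmx ?inverter_block_unit.
by rewrite mulmxBr /B_red mulmxBl -!mulmxA -addrA (addrC (- _)).
Qed.

Hypotheses (hEL : pos_vec EL) (hEIs : pos_vec EIs).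

(** Minimum principle. At an inverter with the least voltage, assumed
    nonpositive, the left-hand side of inverter_equation is nonnegative, as the
    rows of B_II have nonpositive sums and nonnegative off-diagonal entries; the
    right-hand side is negative. *)
Lemma inverter_voltages_gt0 : pos_vec EI.
Proof.
have [i0 minP] : exists i0, forall i, EI i0 0 <= EI i 0.
  have [i _ iP] := @arg_minP _ _ _ (Ordinal hm) xpredT (fun i => EI i 0) isT.
  by exists i => j; exact: iP.
suff pos : 0 < EI i0 0 by move=> i; exact: lt_le_trans (minP i).
rewrite ltNge; apply/negP => le0.
have BIL_ge0 : 0 <= (dlsubmx B *m EL) i0 0.
  rewrite mxE sumr_ge0// => j _; rewrite mulr_ge0 ?(ltW (hEL j))// !mxE.
  by rewrite (susceptance_offdiag_ge0 hB)// eq_sym eq_lrshift.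
have rows : \sum_j drsubmx B i0 j <= 0.
  have := susceptance_row_sum hB (rshift n i0); rewrite big_split_ord/= => h.
  have L0 : 0 <= \sum_(i < n) B (rshift n i0) (lshift m i).
    by apply: sumr_ge0 => j _; rewrite (susceptance_offdiag_ge0 hB)// eq_sym eq_lrshift.
  rewrite (eq_bigr (fun j => B (rshift n i0) (rshift n j))); first by move: h L0; lra.
  by move=> j _; rewrite !mxE.
have BII : (\sum_j drsubmx B i0 j) * EI i0 0 <= (drsubmx B *m EI) i0 0.
  rewrite mulr_suml mxE; apply: ler_sum => j _.
  have [<-//|ij] := eqVneq i0 j.
  by rewrite ler_wpM2l// !mxE (susceptance_offdiag_ge0 hB)// eq_rshift.
have := congr1 (fun v : 'cV_m => v i0 0) inverter_equation.
have addE (u v : 'cV[R]_m) : (u + v) i0 0 = u i0 0 + v i0 0 by rewrite mxE.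
have oppE (u : 'cV[R]_m) : (- u) i0 0 = - u i0 0 by rewrite mxE.
rewrite mulmxDl !addE oppE !dgm_mulE => eq.
have r0 : 0 <= (\sum_j drsubmx B i0 j) * EI i0 0 by rewrite mulr_le0.
have k1 : 0 <= k i0 0 * EI i0 0 by rewrite mulr_le0// ltW.
have k2 : k i0 0 * EIs i0 0 < 0 by rewrite nmulr_rlt0.
by move: eq BIL_ge0 BII r0 k1 k2; lra.
Qed.

End Network.

(** * Linearization of the closed loop *)

Section ClosedLoop.
Context {R : realType} {n m : nat} (e : rel 'I_(n + m)) (B : 'M[R]_(n + m)).
Context (k EIs : 'cV[R]_m) (Q : 'I_n -> R -> R).
Hypotheses (hm : (0 < m)%N) (he : connected_graph e) (hB : susceptance_matrix e B).
Hypotheses (hk : neg_vec k) (hQ : forall i, smooth_pos (Q i)).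
Variables (EL : 'cV[R]_n) (EI : 'cV[R]_m).
Hypotheses (hEL : pos_vec EL) (hEIs : pos_vec EIs).
Hypothesis hpf : 0 = reduced_power_flow B k EIs Q EL.
Hypothesis hEI : EI = W2 B k *m col_mx EL EIs.

Let Ebar := col_mx EL EI.
Let dQ : 'cV[R]_n := \col_i derive1 (Q i) (EL i 0).

(** The derivative of Q_i plus the network current, divided by the voltage: the
    diagonal contribution of the load to the symmetrized Jacobian. At the
    equilibrium it is the derivative of Q_i(y)/y, see load_slopeE. *)
Definition load_slope : 'cV[R]_n :=
  \col_i ((dQ i 0 + usubmx (B *m Ebar) i 0) / EL i 0).
Let q := load_slope.
Let equilibriumI := inverter_equilibrium hB hk hEI.
Let currents := load_currents hm he hB hk hEI.

Lemma jac_QL : jac (QL Q) EL = dgm dQ.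
Proof.
apply/matrixP => i j; rewrite /dgm !mxE /derive.
have [->|ij] := eqVneq i j; last first.
  rewrite mulr0n [X in lim (X @ _)](_ : _ = fun=> 0).
    by apply/cvg_lim => //; exact: cvg_cst.
  apply/funext => h; rewrite /= !mxE.
  by rewrite (negPf ij) mulr0 add0r subrr scaler0.
rewrite mulr1n derive1E /derive [X in lim (X @ _)](_ : _ = fun h =>
  h^-1 *: ((Q j \o shift (EL j 0)) (h *: 1) - Q j (EL j 0)))//.
by apply/funext => h; rewrite /= !mxE !eqxx.
Qed.

Lemma power_flow_balance i : Q i (EL i 0) + EL i 0 * usubmx (B *m Ebar) i 0 = 0.
Proof.
have /colP/(_ i) := hpf; rewrite /reduced_power_flow -mulmxA currents.
by rewrite [LHS]mxE [RHS]mxE dgm_mulE [QL _ _ _ _]mxE => <-.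
Qed.

Lemma J_redE : J_red B k EIs Q EL = dgm EL *m (B_red B k + dgm q).
Proof.
rewrite /J_red jac_QL currents [dgm EL *m (_ + dgm q)]mulmxDr
  [dgm EL *m dgm q]dgmM addrAC -dgmD addrC; congr (_ + dgm _).
by apply/colP => i; rewrite !mxE mulrCA mulfV ?mulr1// gt_eqF.
Qed.

Lemma load_slopeE i : q i 0 = derive1 (Q i) (EL i 0) / EL i 0 - Q i (EL i 0) / EL i 0 ^+ 2.
Proof.
have nz : EL i 0 != 0 by rewrite gt_eqF.
have := power_flow_balance i; rewrite /q /load_slope !mxE.
set u := \sum_j _ => h; have -> : Q i (EL i 0) = - (EL i 0 * u) by lra.
by field.
Qed.

Let Ebar_gt0 : pos_vec Ebar.
Proof.
have EI_gt0 := inverter_voltages_gt0 hm hB hk hEI hEL hEIs.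
by move=> i; rewrite mxE; case: fintype.split.
Qed.

(** The local part of the injection at each bus, so that the closed loop takes
    the form handled by power_flow_strictly_differentiable. *)
Let bus (i : 'I_(n + m)) : R -> R :=
  match fintype.split i with
  | inl j => Q j
  | inr j => fun y => y * k j 0 * (y - EIs j 0)
  end.

Let bus_load j : bus (lshift m j) = Q j.
Proof. by rewrite /bus (unsplitK (inl j)). Qed.

Let bus_inverter j : bus (rshift n j) = fun y => y * k j 0 * (y - EIs j 0).
Proof. by rewrite /bus (unsplitK (inr j)). Qed.

Lemma closed_loopE : closed_loop B k EIs Q =
  (fun E => \col_i bus i (E i 0) + dgm E *m B *m E).
Proof.
apply/funext => E; congr (_ + _); apply/colP => i; rewrite [RHS]mxE.
case: (split_ordP i) => j ->; rewrite ?col_mxEu ?col_mxEd ?bus_load ?bus_inverter.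
  by rewrite !mxE.
by rewrite -mulmxA !dgm_mulE !mxE mulrA.
Qed.

(** Derivatives of the local parts at the equilibrium. *)
Let a : 'cV[R]_(n + m) :=
  col_mx dQ (\col_i (EI i 0 * k i 0 + k i 0 * (EI i 0 - EIs i 0))).

Lemma jacobianE : dgm (a + B *m Ebar) + dgm Ebar *m B = dgm Ebar *m linearization B k q.
Proof.
rewrite /linearization mulmxDr dgmM addrC; congr (_ + dgm _).
rewrite -[B *m Ebar]vsubmxK /a add_col_mx; apply/colP => i.
case: (split_ordP i) => j ->; rewrite [RHS]mxE ?col_mxEu ?col_mxEd [LHS]mxE.
  by rewrite [q j 0]mxE mulrCA mulfV ?mulr1// gt_eqF.
have /colP/(_ j) := equilibriumI; rewrite [LHS]mxE dgm_mulE => h.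
rewrite [(\col_i _) j 0]mxE -addrA.
move: h; rewrite [(EI - EIs) j 0]mxE [(- EIs) j 0]mxE => ->.
by rewrite mxE addr0.
Qed.

Lemma closed_loop_equilibrium : closed_loop B k EIs Q Ebar = 0.
Proof.
rewrite closed_loopE; apply/colP => i; rewrite mxE -mulmxA dgm_mulE.
rewrite [(\col_i bus i _) i 0]mxE [RHS]mxE.
case: (split_ordP i) => j ->; rewrite ?bus_load ?bus_inverter.
  rewrite !col_mxEu; have := power_flow_balance j.
  by rewrite [usubmx _ j 0]mxE.
rewrite !col_mxEd; have /colP/(_ j) := equilibriumI.
rewrite [LHS]mxE dgm_mulE [dsubmx _ j 0]mxE [(EI - EIs) j 0]mxE [(- EIs) j 0]mxE [RHS]mxE => h.
by rewrite -mulrA -mulrDr h mulr0.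
Qed.

Lemma closed_loop_strictly_differentiable :
  strictly_differentiable (closed_loop B k EIs Q) (dgm Ebar *m linearization B k q) Ebar.
Proof.
rewrite closed_loopE -jacobianE; apply: power_flow_strictly_differentiable => i.
rewrite /a /Ebar; case: (split_ordP i) => j ->; rewrite ?bus_load ?bus_inverter.
  rewrite !col_mxEu mxE; apply: C1_strictly_differentiable.
    near=> t; apply: (@hQ j 0%N); near: t; exact: lt_nbhsr.
  apply/differentiable_continuous/derivable1_diffP.
  exact: (@hQ j 1%N _ (hEL j)).
rewrite !col_mxEd mxE; exact: quadratic_strictly_differentiable.
Unshelve. all: by end_near. Qed.

Let S_sym : (B_red B k + dgm q)^T = B_red B k + dgm q.
Proof. by rewrite linearD/= (B_red_sym k hB) tr_dgm. Qed.

Lemma closed_loop_stable tau : pos_vec tau -> hurwitz (J_red B k EIs Q EL) ->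
  locally_exponentially_stable tau (closed_loop B k EIs Q) Ebar.
Proof.
rewrite J_redE => tau_gt0 /(hurwitz_negdef hEL S_sym) nS.
apply: (linearized_stability Ebar_gt0 _ tau_gt0 closed_loop_equilibrium
  closed_loop_strictly_differentiable).
exact: (negdef_linearization hB hk nS).
Qed.

(** The hypotheses bound the form of B_red + [q] by that of B_red - [w], where
    w_i = Q_i/EL_i^2. *)
Lemma J_red_hurwitz :
  (forall i, derive1 (Q i) (EL i 0) <= 0) ->
  mx_prec (B_red B k) (invmx (dgm EL *m dgm EL) *m dgm (QL Q EL)) ->
  hurwitz (J_red B k EIs Q EL).
Proof.
move=> dQ_le0 prec; rewrite J_redE; apply: (negdef_hurwitz hEL S_sym) => x x0.
pose w : 'cV[R]_n := \col_i (Q i (EL i 0) / EL i 0 ^+ 2).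
have invE : invmx (dgm EL *m dgm EL) *m dgm (QL Q EL) = dgm w.
  have U : dgm EL *m dgm EL \in unitmx.
    by have /mulmx1_unit[u _] := dgmK hEL; rewrite unitmx_mul u.
  rewrite -(mulKmx U (dgm w)) dgmM dgmM; congr (_ *m dgm _).
  apply/colP => i; rewrite !mxE; have nz : EL i 0 != 0 by rewrite gt_eqF.
  by field.
have := prec x x0; rewrite invE -mulmxA dotE mulmxBl dotDr dotNr subr_gt0 => lt.
rewrite mulmxDl dotDr -ltrBrDr; apply: lt_le_trans lt _.
rewrite sub0r -dotNr; apply: ler_sum => i _.
rewrite [in leRHS]mxE !dgm_mulE load_slopeE mxE.
have := dQ_le0 i; have := sqr_ge0 (x i 0).
set u := Q i _ / _ => x2 d0.
have d1 : derive1 (Q i) (EL i 0) / EL i 0 <= 0 by rewrite mulr_le0_ge0// invr_ge0 ltW.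
have := mulr_ge0_le0 x2 d1; lra.
Qed.

End ClosedLoop.

Theorem mainTheorem2 (R : realType) (n m : nat) (hn : (1 <= n)%N)
  (hm : (1 <= m)%N) (e : rel 'I_(n + m)) (B : 'M[R]_(n + m))
  (he : connected_graph e) (hB : susceptance_matrix e B)
  (EIs k tau : 'cV[R]_m) (hEIs : pos_vec EIs) (hk : neg_vec k)
  (htau : pos_vec tau)
  (Q : 'I_n -> R -> R) (hQ : forall i, smooth_pos (Q i))
  (EL : 'cV[R]_n) (EI : 'cV[R]_m) (hEL : pos_vec EL)
  (hpf : 0 = reduced_power_flow B k EIs Q EL)
  (hEI : EI = W2 B k *m col_mx EL EIs) :
  (hurwitz (J_red B k EIs Q EL) ->
     locally_exponentially_stable tau (closed_loop B k EIs Q) (col_mx EL EI))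
  /\
  ((forall i, derive1 (Q i) (EL i 0) <= 0) ->
   mx_prec (B_red B k) (invmx (dgm EL *m dgm EL) *m dgm (QL Q EL)) ->
   hurwitz (J_red B k EIs Q EL)).
Proof.
split; first exact: (closed_loop_stable hm he hB hk hQ hEL hEIs hpf hEI htau).
exact: (J_red_hurwitz hm he hB hk hEL hpf hEI).
Qed.
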